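(* Let $N$ be an infinite, finitely generated nilpotent group such that $N/T(N)$ has step length $c>1$. Then the natural number $\dim_{\mathrm{RFL}}(N)$ (the lower residual dimension of $N$) satisfies $\dim_{\mathrm{RFL}}(N)\ge c+1$ and $$\left(\log(n)\right)^{\dim_{\mathrm{RFL}}(N)} \precsim \mathrm{F}_{N}(n).$$
   Context: $\mathbb{N}=\{1,2,3,\dots\}$; $\mathbb{P}$ is the set of primes. Growth functions. For a finitely generated group $G$ and $g\in G\setminus\{1\}$ let $\mathrm{D}_G(g)=\min\{|Q| : \varphi:G\to Q \text{ is a group homomorphism}, |Q|<\infty, \varphi(g)\neq 1\}$. For a residually finite group $G$ (finitely generated nilpotent groups are such) with finite generating set $S$ and word length $\|\cdot\|_S$, let $\mathrm{F}_{G,S}(n)=\max\{\mathrm{D}_G(g) : g\in G\setminus\{1\}, \|g\|_S\le n\}$. For nondecreasing functions $f,g$ of $n\in\mathbb{N}$, $f\precsim g$ means there is $C>0$ with $f(n)\le C\,g(Cn)$ for all $n$; $f\approx g$ means $f\precsim g$ and $g\precsim f$. Up to $\approx$, $\mathrm{F}_{G,S}$ is independent of $S$ and is written $\mathrm{F}_G$. Nilpotent groups. $\gamma_1(N)=N$, $\gamma_i(N)=[\gamma_{i-1}(N),N]$; the step length of $N$ is the least natural number $c$ with $\gamma_{c+1}(N)=\{1\}$. $T(N)$ is the subgroup of finite order elements; $N/T(N)$ is torsion free. $h(N)$ denotes the Hirsch length. For $H\le N$, the isolator is $\sqrt{H}=\{g\in N : g^k\in H \text{ for some } k\in\mathbb{N}\}$;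 for $N$ torsion free, $\sqrt{\gamma_c(N)}$ ($c$ the step length) is a central subgroup. An infinite order element $g$ of a torsion free finitely generated group is primitive if $h^m=g$ with $h$ in the group and $m$ a nonzero integer implies $g=h$ or $g=h^{-1}$. Residual dimension. Let $N$ be torsion free, finitely generated nilpotent, $z\in Z(N)$ primitive, $p$ a prime. A $p$-witness of $z$ is a surjective homomorphism $\varphi:N\to P$ onto a finite $p$-group with $\varphi(z)\ne1$ and $|P|=p^k$, where $k$ is the smallest $m$ for which there is a surjective homomorphism $N\to Q$ onto a finite $p$-group of order $p^m\le p^{h(N)}$ not killing $z$ (such homomorphisms exist for every $p$). For $1\le i\le h(N)$ let $\mathrm{RP}_{N,z,i}=\{p\in\mathbb{P} : p^i \text{ is the order of a } p\text{-witness of } z\}$. If $N$ has step length $c$ and $z\in\sqrt{\gamma_c(N)}$ is primitive, $\dim_{\mathrm{RFL}}(N,z)$ is the least $t$ with $\mathrm{RP}_{N,z,t}$ infinite. Define $\dim_{\mathrm{RFL}}(N)=\max\{\dim_{\mathrm{RFL}}(N,z) : z\in\sqrt{\gamma_c(N)} \text{ primitive}\}$. For an infinite, finitely generated nilpotent group $N$, set $\dim_{\mathrm{RFL}}(N)=\dim_{\mathrm{RFL}}(N/T(N))$. *)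

(* Defs.v *)
From HB Require Import structures.
From mathcomp Require Import all_boot all_order ssralg ssrnum ssrint.
From mathcomp Require Import fingroup pgroup.
From mathcomp Require Import boolp classical_sets functions cardinality reals exp.

Set Implicit Arguments.
Unset Strict Implicit.
Unset Printing Implicit Defensive.

Import Order.TTheory GRing.Theory Num.Theory.

Local Open Scope classical_set_scope.
Local Open Scope group_scope.

(* Minimum and maximum of a set of natural numbers; the value is 0 when the
   minimum (maximum) does not exist. *)
Definition nat_min (A : set nat) : nat :=
  xget 0%N [set m | A m /\ forall k, A k -> (m <= k)%N].

Definition nat_max (A : set nat) : nat :=
  xget 0%N [set m | A m /\ forall k, A k -> (k <= m)%N].

Notation hom G H := (UMagmaMorphism.type G H).

Definition surjective (A B : Type) (f : A -> B) : Prop :=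
  forall y, exists x, f x = y.

Section Groups.
Variable G : groupType.
Implicit Types (A H K : set G) (S : seq G) (g x y z : G).

Definition zexpg g (m : int) : G :=
  match m with Posz n => g ^+ n | Negz n => g ^- n.+1 end.

Definition subgroup H : Prop :=
  H 1 /\ forall x y, H x -> H y -> H (x * y^-1).

Definition normal_subgroup H : Prop :=
  subgroup H /\ forall x y, H x -> H (x ^ y).

Definition generated A : set G := smallest subgroup A.

Definition normal_closure A : set G := smallest normal_subgroup A.

Definition torsion : set G := [set g | exists2 k, (0 < k)%N & g ^+ k = 1].

Definition isolator H : set G :=
  [set g | exists2 k, (0 < k)%N & H (g ^+ k)].

Definition primitive g : Prop :=
  ~ torsion g /\
  forall h (m : int), m != 0%R -> zexpg h m = g -> g = h \/ g = h^-1.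

(* gamma 1 is the whole group; gamma 0 is a junk value. *)
Definition gamma (i : nat) : set G :=
  iter i.-1
    (fun H => generated [set g | exists x y, H x /\ g = [~ x, y]]) setT.

Definition nilpotent_group : Prop := exists c, gamma c.+1 = [set 1].

Definition step_length : nat :=
  nat_min [set c | (0 < c)%N /\ gamma c.+1 = [set 1]].

(* K is normal in H, and H / K is cyclic, generated by the coset of x. *)
Definition cyclic_extension K H x : Prop :=
  [/\ subgroup K /\ subgroup H,
      K `<=` H,
      (forall k h, K k -> H h -> K (k ^ h)),
      H x &
      forall h, H h -> exists m : int, K (h * (zexpg x m)^-1)].

(* cyclic_series H n: there is a subnormal series from 1 to H with cyclic
   factors, exactly n of which are infinite. *)
Inductive cyclic_series : set G -> nat -> Prop :=
| cyclic_series1 : cyclic_series [set 1] 0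
| cyclic_series_inf K H x n :
    cyclic_series K n -> cyclic_extension K H x ->
    (forall k, (0 < k)%N -> ~ K (x ^+ k)) ->
    cyclic_series H n.+1
| cyclic_series_fin K H x n k :
    cyclic_series K n -> cyclic_extension K H x ->
    (0 < k)%N -> K (x ^+ k) ->
    cyclic_series H n.

(* For a polycyclic group the number n does not depend on the series. *)
Definition hirsch_length : nat := xget 0%N [set n | cyclic_series setT n].

Definition words S : set (seq G) :=
  [set w | forall x, x \in w -> x \in S \/ x^-1 \in S].

Definition generates S : Prop :=
  forall g, exists2 w, words S w & \prod_(x <- w) x = g.

Definition finitely_generated : Prop := exists S, generates S.

Definition word_length S g : nat :=
  nat_min [set l | exists2 w, words S w & \prod_(x <- w) x = g /\ size w = l].

Definition rf_depth g : nat :=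
  nat_min [set q | exists (Q : finGroupType) (phi : hom G Q),
                     phi g <> 1 /\ #|Q| = q].

Definition rf_growth S (n : nat) : nat :=
  nat_max [set d | exists g, [/\ g <> 1, (word_length S g <= n)%N
                                & rf_depth g = d]].

Definition p_detects z (p : nat) (P : finGroupType) (phi : hom G P) : Prop :=
  [/\ surjective phi, p.-group [set: P]%SET & phi z <> 1].

Definition witness_exponent z (p : nat) : nat :=
  nat_min [set m | exists (Q : finGroupType) (phi : hom G Q),
    [/\ p_detects z p phi, #|Q| = (p ^ m)%N
      & (p ^ m <= p ^ hirsch_length)%N]].

Definition p_witness z (p : nat) (P : finGroupType) (phi : hom G P) : Prop :=
  p_detects z p phi /\ #|P| = (p ^ witness_exponent z p)%N.

Definition RP z (i : nat) : set nat :=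
  [set p | prime p /\ exists (P : finGroupType) (phi : hom G P),
             p_witness z p phi /\ #|P| = (p ^ i)%N].

Definition dim_RFL_at z : nat :=
  nat_min [set t | (1 <= t <= hirsch_length)%N /\ infinite_set (RP z t)].

Definition dim_RFL_torsion_free : nat :=
  nat_max [set d | exists z, [/\ isolator (gamma step_length) z,
                                 primitive z & dim_RFL_at z = d]].

End Groups.

Arguments torsion : clear implicits.
Arguments gamma : clear implicits.
Arguments nilpotent_group : clear implicits.
Arguments step_length : clear implicits.
Arguments hirsch_length : clear implicits.
Arguments finitely_generated : clear implicits.
Arguments dim_RFL_torsion_free : clear implicits.

Lemma normal_closure_normal (G : groupType) (A : set G) :
  normal_subgroup (normal_closure A).
Proof.
split; [split|].
- by move=> H [[[]]].
- move=> x y Ax Ay H sH; case: (sH) => [[[_ dH] _] _].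
  by apply: dH; [apply: Ax | apply: Ay].
- move=> x y Ax H sH; case: (sH) => [[_ cH] _].
  by apply: cH; apply: Ax.
Qed.

Lemma normal_closure_id (G : groupType) (H : set G) :
  normal_subgroup H -> normal_closure H = H.
Proof. exact: smallest_id. Qed.

(* The quotient of G by the normal closure of A; this is G / A as soon as A is
   a normal subgroup (normal_closure_id), as is torsion N for N nilpotent. *)
Section Quotient.
Variables (G : groupType) (A : set G).
Local Notation H := (normal_closure A).

Definition coset_rel : rel G := fun x y => `[< H (x^-1 * y) >].

Let H1 : H 1. Proof. by case: (normal_closure_normal A) => -[]. Qed.

Let Hdiv x y : H x -> H y -> H (x * y^-1).
Proof. by case: (normal_closure_normal A) => -[_ +] _; apply. Qed.

Let HJ x y : H x -> H (x ^ y).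
Proof. by case: (normal_closure_normal A) => _; apply. Qed.

Let HV x : H x -> H x^-1.
Proof. by move=> Hx; rewrite -[x^-1]mul1g; apply: Hdiv. Qed.

Let HM x y : H x -> H y -> H (x * y).
Proof. by move=> Hx Hy; rewrite -[y]invgK; apply: Hdiv => //; apply: HV. Qed.

Lemma coset_rel_equiv : equiv_class_of coset_rel.
Proof.
split=> [x|x y|y x z].
- by apply/asboolP; rewrite mulVg.
- by apply/asboolP/asboolP => /HV; rewrite invgM invgK.
- move=> /asboolP Hxy /asboolP Hyz; apply/asboolP.
  by have := HM Hxy Hyz; rewrite mulgA mulgK.
Qed.

Canonical coset_equiv := EquivRelPack coset_rel_equiv.

Definition quotient_group := {eq_quot coset_rel}%qT.

HB.instance Definition _ := Choice.on quotient_group.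
HB.instance Definition _ := EqQuotient.on quotient_group.

Definition quotient_proj (x : G) : quotient_group := (\pi_quotient_group x)%qT.

Local Notation rep := (@generic_quotient.repr G quotient_group).

Let piP x y : quotient_proj x = quotient_proj y <-> H (x^-1 * y).
Proof.
split=> [/eqquotP/asboolP //|Hxy]; apply/eqquotP; exact/asboolP.
Qed.

Let projW (P : quotient_group -> Prop) :
  (forall x, P (quotient_proj x)) -> forall a, P a.
Proof. by move=> h a; rewrite -[a]reprK; apply: h. Qed.

Let piM x1 x2 y1 y2 :
  H (x1^-1 * x2) -> H (y1^-1 * y2) -> H ((x1 * y1)^-1 * (x2 * y2)).
Proof.
move=> Hx Hy; have -> : (x1 * y1)^-1 * (x2 * y2) =
    (x1^-1 * x2) ^ y1 * (y1^-1 * y2).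
  by rewrite /conjg invgM !mulgA mulgK.
by apply: HM => //; apply: HJ.
Qed.

Let reprH x : H ((rep (quotient_proj x))^-1 * x).
Proof. by apply/piP; rewrite /quotient_proj reprK. Qed.

Let qone : quotient_group := quotient_proj 1.
Let qinv (a : quotient_group) : quotient_group := quotient_proj (rep a)^-1.
Let qmul (a b : quotient_group) : quotient_group := quotient_proj (rep a * rep b).

Let qmulE x y :
  qmul (quotient_proj x) (quotient_proj y) = quotient_proj (x * y).
Proof.
by apply/piP; apply: (piM (reprH x) (reprH y)).
Qed.

Let qinvE x : qinv (quotient_proj x) = quotient_proj x^-1.
Proof.
apply/piP; rewrite invgK.
have := HJ x^-1 (HV (reprH x)); rewrite invgM invgK /conjg invgK.
by rewrite !mulgA mulgV mul1g.
Qed.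

Let qmulA : associative qmul.
Proof.
elim/projW=> x; elim/projW=> y; elim/projW=> z.
by rewrite !qmulE mulgA.
Qed.

Let qmul1 : left_id qone qmul.
Proof. by elim/projW=> x; rewrite qmulE mul1g. Qed.

Let qmulr1 : right_id qone qmul.
Proof. by elim/projW=> x; rewrite qmulE mulg1. Qed.

Let qmulV : left_inverse qone qinv qmul.
Proof. by elim/projW=> x; rewrite qinvE qmulE mulVg. Qed.

Let qmulrV : right_inverse qone qinv qmul.
Proof. by elim/projW=> x; rewrite qinvE qmulE mulgV. Qed.

HB.instance Definition _ :=
  isGroup.Build quotient_group qmulA qmul1 qmulr1 qmulV qmulrV.

Lemma quotient_projM (x y : G) :
  quotient_proj (x * y) = quotient_proj x * quotient_proj y.
Proof. exact/esym/qmulE. Qed.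

Lemma quotient_proj_surj : surjective quotient_proj.
Proof. by elim/projW=> x; exists x. Qed.

Lemma quotient_projP (x : G) :
  quotient_proj x = 1 <-> normal_closure A x.
Proof.
split=> [/esym/piP|Hx]; first by rewrite invg1 mul1g.
by apply/esym/piP; rewrite invg1 mul1g.
Qed.

End Quotient.

Definition mod_torsion (N : groupType) : groupType :=
  quotient_group (torsion N).

Definition dim_RFL (N : groupType) : nat :=
  dim_RFL_torsion_free (mod_torsion N).

(* f and g are functions on {1, 2, ...}, so the constant C rescaling the
   argument is a positive natural number; the value at 0 is never used. *)
Definition precsim (R : realType) (f g : nat -> R) : Prop :=
  exists2 C, (0 < C)%N &
    forall n, (0 < n)%N -> (f n <= C%:R * g (C * n)%N)%R.

(* Main.v *)
From HB Require Import structures.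
Require Import Defs.
From mathcomp Require Import all_boot all_order ssralg ssrnum ssrint intdiv.
From mathcomp Require Import fingroup morphism pgroup quotient cyclic.
From mathcomp Require Import nilpotent sylow.
From mathcomp Require Import boolp classical_sets functions cardinality.
From mathcomp Require Import reals sequences exp.
From mathcomp Require Import zify.

(** Let M = N/T(N), let d be the residual dimension, and let z in M attain it.

    Lower bound on the dimension. A p-group of order at most p^c, where c > 1
    is the step length, has class less than c. It therefore kills gamma_c(M),
    and for large p also every element of the isolator of gamma_c(M). So
    witnesses have order at least p^(c+1) for large p, [dim_RFL_at_gt_step].

    Existence of witnesses. The minima in the definitions are meaningful only
    if, for infinitely many p, some quotient of M of order at most p^h, h the
    Hirsch length, does not kill z. The quotient of M by all p-th powers is
    such a quotient for all large p, [p_quotient]. Its order is at most p^h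
    since each infinite factor of a cyclic series contributes at most p and
    each finite one of order prime to p contributes nothing. It does not kill z
    because there is a polynomial function f from M to the integers with
    f(z) <> f(1), [torsion_free_separated]: by Newton's formula
    f(g^p x) = f(x) modulo p as soon as p is at least a bound on the degree of
    f, so f modulo p descends to the quotient, where it separates z from 1 if
    p does not divide f(z) - f(1). These functions are built along a central
    series of M with infinite cyclic factors, by extending f from K to K<x> by
    F(k x^n) = f(k). That F is again polynomial follows from measuring degrees
    with weights along the lower central series, because conjugation then acts
    unipotently, [poly_conj_sub] and [poly_lift].

    Lower bound on the growth. By minimality of d, for all large p every
    p-quotient of M that detects z has order at least p^d. Let L be a number
    divisible by all prime powers up to n = 2^k, and of size exp(O(n)) as in
    Chebyshev's estimates, [binom_prod]. A finite quotient of N that detects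
    the power L^(2d) of a preimage of z may be replaced by a p-group,
    [p_component]. If p <= n then L^(2d) forces its order above n^d; if p > n
    then torsion of N is killed, so that the quotient is one of M and has order
    at least p^d > n^d. As this element has word length exp(O(n)), the growth
    function is at least n^d at exp(O(n)), [depth_lower_bound] and
    [log_power_growth]. *)

Set Implicit Arguments.
Unset Strict Implicit.
Unset Printing Implicit Defensive.

Import Order.TTheory GRing.Theory Num.Theory.

Local Open Scope classical_set_scope.
Local Open Scope group_scope.

(** * Integer powers, subgroups and the lower central series *)

Lemma nat_minP (A : set nat) :
  (exists a, A a) -> A (nat_min A) /\ forall k, A k -> (nat_min A <= k)%N.
Proof.
case=> a Aa; rewrite /nat_min; case: xgetP => [m _ //|no].
have exA : exists n, `[< A n >] by exists a; apply/asboolP.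
case: (ex_minnP exA) no => m /asboolP Am leA /(_ m) []; split=> // k Ak.
by apply/leA/asboolP.
Qed.

Lemma nat_maxP (A : set nat) B :
  (exists a, A a) -> (forall a, A a -> (a <= B)%N) ->
  A (nat_max A) /\ forall k, A k -> (k <= nat_max A)%N.
Proof.
case=> a Aa AB; rewrite /nat_max; case: xgetP => [m _ //|no].
have exA : exists n, `[< A n >] by exists a; apply/asboolP.
have leB n : `[< A n >] -> (n <= B)%N by move/asboolP/AB.
case: (ex_maxnP exA leB) no => m /asboolP Am leA /(_ m) []; split=> // k Ak.
by apply/leA/asboolP.
Qed.

Section Powers.
Variable G : groupType.
Implicit Types (x y : G) (m n : int).

Lemma zexpgS x m : zexpg x (m + 1) = zexpg x m * x.
Proof.
case: m => [n|[|n]].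
- have -> : (Posz n + 1 = Posz n.+1)%R by rewrite -addn1 PoszD.
  by rewrite /= expgSr.
- by rewrite /= mulVg.
- have -> : (Negz n.+1 + 1 = Negz n)%R.
    by rewrite !NegzE -[n.+2]addn1 PoszD opprD addrNK.
  by rewrite /= [x ^+ n.+2]expgS invgM mulgVK.
Qed.

Lemma zexpgD x m n : zexpg x (m + n) = zexpg x m * zexpg x n.
Proof.
elim/int_ind: n => [|n IH|n IH].
- by rewrite addr0 /= mulg1.
- by rewrite -addn1 PoszD addrA !zexpgS IH mulgA.
- apply: (mulIg x); rewrite -mulgA -!zexpgS -addrA.
  have -> : (- n.+1%:Z + 1 = - n%:Z)%R.
    by rewrite -[n.+1]addn1 PoszD opprD addrNK.
  exact: IH.
Qed.

Lemma zexpgN x m : zexpg x (- m) = (zexpg x m)^-1.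
Proof. by apply/esym/mulg1_eq; rewrite -zexpgD subrr. Qed.

Lemma zexpgB x m n : zexpg x (m - n) = zexpg x m * (zexpg x n)^-1.
Proof. by rewrite zexpgD zexpgN. Qed.

Lemma zexpgM x m n : zexpg x (m * n) = zexpg (zexpg x m) n.
Proof.
elim/int_ind: n => [|n IH|n IH]; first by rewrite mulr0.
- have -> : (Posz n.+1 = Posz n + 1)%R by rewrite -addn1 PoszD.
  by rewrite zexpgS mulrDr mulr1 zexpgD IH.
- apply: (mulIg (zexpg x m)); rewrite -zexpgS -zexpgD.
  have -> : (- n.+1%:Z + 1 = - n%:Z)%R.
    by rewrite -[n.+1]addn1 PoszD opprD addrNK.
  have -> : (m * - n.+1%:Z + m = m * - n%:Z)%R.
    by rewrite -[n.+1]addn1 PoszD opprD mulrDr mulrN1 addrNK.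
  exact: IH.
Qed.

Lemma zexpg_conj x y m : (zexpg x m) ^ y = zexpg (x ^ y) m.
Proof. by case: m => n /=; rewrite ?conjVg conjXg. Qed.

Lemma commute_zexpg x y m : commute x y -> commute x (zexpg y m).
Proof. by move=> xy; case: m => n /=; [|apply: commuteV]; apply: commuteX. Qed.

End Powers.

Lemma zexpgMn (G : groupType) (x y : G) m :
  commute x y -> zexpg (x * y) m = zexpg x m * zexpg y m.
Proof.
move=> xy; case: m => n /=; first exact: expgMn.
rewrite expgMn // invgM; apply/commute_sym/commuteV/commute_sym/commuteV.
exact: commuteX2.
Qed.

Lemma hom_zexpg (G H : groupType) (phi : hom G H) x m :
  phi (zexpg x m) = zexpg (phi x) m.
Proof. by case: m => n /=; rewrite ?gmulfV gmulfXn. Qed.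

Section Subgroups.
Variable G : groupType.
Implicit Types (H K A : set G) (x y : G).

Lemma subgroup1 H : subgroup H -> H 1. Proof. by case. Qed.

Lemma subgroupV H x : subgroup H -> H x -> H x^-1.
Proof. by case=> H1 HD Hx; rewrite -[x^-1]mul1g; apply: HD. Qed.

Lemma subgroupM H x y : subgroup H -> H x -> H y -> H (x * y).
Proof.
by move=> sH Hx Hy; rewrite -[y]invgK; apply: sH.2 => //; apply: subgroupV.
Qed.

Lemma subgroupX H x n : subgroup H -> H x -> H (x ^+ n).
Proof.
move=> sH Hx; elim: n => [|n IH]; first exact: subgroup1.
by rewrite expgS; apply: subgroupM.
Qed.

Lemma subgroupZ H x m : subgroup H -> H x -> H (zexpg x m).
Proof.
by move=> sH Hx; case: m => n /=; [|apply: subgroupV => //]; apply: subgroupX.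
Qed.

Lemma generated_subgroup A : subgroup (Defs.generated A).
Proof.
split=> [H [sH _]|x y Ax Ay H sH]; first exact: subgroup1.
by case: (sH) => sH' _; apply: sH'.2; [apply: Ax | apply: Ay].
Qed.

Lemma generated_sub A : A `<=` Defs.generated A.
Proof. by move=> x Ax H [_]; apply. Qed.

Lemma generated_min A H : subgroup H -> A `<=` H -> Defs.generated A `<=` H.
Proof. by move=> sH AH x; apply. Qed.

Lemma subgroupT : subgroup [set: G]. Proof. by []. Qed.

Lemma normal_subgroup1 : normal_subgroup [set 1 : G].
Proof.
split; first by split=> // x y -> ->; rewrite /= mulgV.
by move=> x y ->; rewrite /= conj1g.
Qed.

Lemma gammaS i :
  gamma G i.+2 =
    Defs.generated [set g | exists x y, gamma G i.+1 x /\ g = [~ x, y]].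
Proof. by []. Qed.

Lemma gamma_subgroup i : subgroup (gamma G i).
Proof. by case: i => [|[|i]] //; exact: generated_subgroup. Qed.

Lemma gamma_comm i x y : gamma G i.+1 x -> gamma G i.+2 [~ x, y].
Proof. by move=> gx; rewrite gammaS; apply: generated_sub; exists x, y. Qed.

Lemma gamma_normal_step i :
  normal_subgroup (gamma G i.+1) /\ gamma G i.+2 `<=` gamma G i.+1.
Proof.
elim: i => [|i [nI sI]]; first by split=> // x y.
have n2 : normal_subgroup (gamma G i.+2).
  split=> [|x y gx]; first exact: gamma_subgroup.
  have -> : x ^ y = x * [~ x, y] by rewrite commgEl mulVKg.
  apply: (subgroupM (gamma_subgroup i.+2)) => //.
  by apply: gamma_comm; apply: sI.
split=> //; rewrite [X in X `<=` _]gammaS.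
apply: generated_min; first exact: gamma_subgroup.
move=> _ [x [y [gx ->]]]; rewrite commgEl.
apply: (subgroupM (gamma_subgroup i.+2)); last exact: n2.2.
exact: (subgroupV (gamma_subgroup i.+2)).
Qed.

Lemma gamma_normal i : normal_subgroup (gamma G i).
Proof. by case: i => [|i]; [split | case: (gamma_normal_step i)]. Qed.

Lemma gamma_anti i j : (i <= j)%N -> gamma G j.+1 `<=` gamma G i.+1.
Proof.
move/subnK=> <-; elim: (j - i)%N => [//|k IH].
apply: subset_trans IH; rewrite addSn; exact: (gamma_normal_step _).2.
Qed.

End Subgroups.

Lemma hom_gamma (G H : groupType) (phi : hom G H) i x :
  gamma G i x -> gamma H i (phi x).
Proof.
elim: i x => [//|[//|i] IH] x; rewrite gammaS => gx.
have sub : subgroup [set u : G | gamma H i.+2 (phi u)].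
  split=> [|u v /= gu gv].
    by rewrite /= gmulf1; exact: (subgroup1 (gamma_subgroup H _)).
  by rewrite /= gmulfF; apply: (gamma_subgroup H i.+2).2.
apply: (generated_min sub _ gx) => _ [u [v [gu ->]]] /=.
by rewrite gmulfR; apply: gamma_comm; apply: IH.
Qed.

Lemma surj_gamma (G H : groupType) (phi : hom G H) i y :
  surjective phi -> gamma H i y -> exists2 x, gamma G i x & phi x = y.
Proof.
move=> sphi; elim: i y => [|[|i] IH] y; try by case: (sphi y) => x <-; exists x.
rewrite gammaS => gy.
suff: [set v | exists2 x, gamma G i.+2 x & phi x = v] y by [].
apply: (generated_min _ _ gy); first split.
- by exists 1; [exact: (subgroup1 (gamma_subgroup G _)) | exact: gmulf1].
- move=> _ _ [u gu <-] [v gv <-]; exists (u * v^-1); last by rewrite gmulfF.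
  exact: (gamma_subgroup G i.+2).2.
- move=> _ [u [v [/IH [u' gu' <-] ->]]]; case: (sphi v) => v' <-.
  by exists [~ u', v']; [apply: gamma_comm | rewrite gmulfR].
Qed.

Lemma hom_of (G H : groupType) (f : G -> H) :
  {morph f : x y / x * y} -> exists phi : hom G H, forall x, phi x = f x.
Proof.
move=> fM.
have fF : {morph f : x y / x * y^-1}.
  move=> x y; apply: (mulIg (f y)); rewrite mulgVK -fM mulgVK.
  by [].
pose phi : hom G H := HB.pack f (isGroupMorphism.Build G H f fF).
by exists phi.
Qed.

(** * Series with cyclic factors *)

(** The coset of [h] modulo [K] is that of [x ^ m]. This is a relation and not
    a function of [h] because [m] matters only modulo the order of [x] in the
    quotient [H / K], which may be finite. *)
Definition ext_rel (G : groupType) (K H : set G) (x h : G) (m : int) : Prop :=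
  H h /\ K (h * (zexpg x m)^-1).

Section CyclicExtension.
Variables (G : groupType) (K H : set G) (x : G).
Hypothesis ext : cyclic_extension K H x.
Local Notation R := (ext_rel K H x).

Let sK : subgroup K. Proof. by case: ext => -[]. Qed.
Let sH : subgroup H. Proof. by case: ext => -[]. Qed.
Let nK k h : K k -> H h -> K (k ^ h).
Proof. by case: ext => _ _ + _ _; apply. Qed.

Let Hx : H x. Proof. by case: ext. Qed.

Lemma ext_rel0 h : R h 0 <-> K h.
Proof.
rewrite /ext_rel /= invg1 mulg1; split=> [[]//|Kh]; split=> //.
by case: ext => _ + _ _ _; apply.
Qed.

Lemma ext_rel_ex h : H h -> exists m, R h m.
Proof. by move=> Hh; case: ext => _ _ _ _ /(_ h Hh) [m Km]; exists m. Qed.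

Lemma ext_relM h h' m m' : R h m -> R h' m' -> R (h * h') (m + m').
Proof.
move=> [Hh Km] [Hh' Km']; split; first exact: subgroupM.
have -> : h * h' * (zexpg x (m + m'))^-1 =
    (h * (zexpg x m)^-1) * (h' * (zexpg x m')^-1) ^ (zexpg x m)^-1.
  by rewrite zexpgD /conjg invgM invgK !mulgA mulgVK.
apply: subgroupM => //; apply: nK => //.
by apply: subgroupV => //; apply: subgroupZ.
Qed.

Lemma ext_relV h m : R h m -> R h^-1 (- m).
Proof.
move=> [Hh Km]; split; first exact: subgroupV.
have -> : h^-1 * (zexpg x (- m))^-1 = ((h * (zexpg x m)^-1)^-1) ^ (zexpg x m).
  by rewrite zexpgN invgK /conjg invgM invgK !mulgA mulVg mul1g.
by apply: nK; [apply: subgroupV | apply: subgroupZ].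
Qed.

Lemma ext_relZ h m q : R h m -> R (zexpg h q) (m * q).
Proof.
move=> Rh; have R0 : R 1 0 by exact: ((ext_rel0 1).2 (subgroup1 sK)).
have RX n : R (h ^+ n) (m * n%:Z).
  elim: n => [|n IH]; first by rewrite mulr0.
  have -> : (Posz n.+1 = Posz n + 1)%R by rewrite -addn1 PoszD.
  by rewrite mulrDr mulr1 expgSr; apply: ext_relM.
case: q => n; first exact: RX.
by rewrite NegzE mulrN; exact: (ext_relV (RX n.+1)).
Qed.

Lemma ext_relX h m n : R h m -> R (h ^+ n) (m * n%:Z).
Proof. exact: (@ext_relZ h m (Posz n)). Qed.

Lemma ext_rel_inj : (forall k, (0 < k)%N -> ~ K (x ^+ k)) ->
  forall h m m', R h m -> R h m' -> m = m'.
Proof.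
move=> infx h m m' Rm Rm'.
have : R (h * h^-1) (m - m') by apply: ext_relM => //; apply: ext_relV.
rewrite mulgV => -[_]; rewrite mul1g => /(subgroupV sK); rewrite invgK => Kd.
apply/eqP; rewrite -subr_eq0 -absz_eq0 -leqn0 leqNgt; apply/negP => d0.
apply: (infx _ d0); case: (m - m')%R Kd => n //= Kn.
by rewrite -[x ^+ _]invgK; apply: subgroupV.
Qed.

End CyclicExtension.

Definition max_condition (G : groupType) (H : set G) : Prop :=
  forall F : set (set G), (exists A, F A) ->
  (forall A, F A -> subgroup A /\ A `<=` H) ->
  exists2 A, F A & forall B, F B -> A `<=` B -> B `<=` A.

(** A subgroup [A] of [H] is determined among the subgroups containing it by
    [A `&` K] and the least positive exponent of [x] modulo [K] that occurs in
    [A], so maximise the former first and then minimise the latter. *)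
Lemma max_condition_ext (G : groupType) (K H : set G) x :
  cyclic_extension K H x -> max_condition K -> max_condition H.
Proof.
move=> ext maxK F [A0 FA0] FP.
have sK : subgroup K by case: ext => -[].
have [_ [A FA <-] Amax] : exists2 B, (exists2 A, F A & A `&` K = B) &
    forall C, (exists2 A, F A & A `&` K = C) -> B `<=` C -> C `<=` B.
  apply: maxK => [|B [A FA <-]]; first by exists (A0 `&` K), A0.
  case: (FP _ FA) => sA _; split; last by move=> g [].
  split=> [|u v [Au Ku] [Av Kv]]; first by split; apply: subgroup1.
  by split; [apply: sA.2 | apply: sK.2].
(* the members of [F] that contain [A `&` K], and therefore meet [K] in exactly
   this set by its maximality *)
pose big B := F B /\ A `<=` B `|` ~` K.
have bigK B : big B -> B `&` K `<=` A.
  move=> [FB AB] g gBK; suff: (A `&` K) g by case.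
  apply: (Amax (B `&` K)) gBK; first by exists B.
  by move=> u [Au Ku]; case: (AB u Au).
have bigW B C : big B -> F C -> B `<=` C -> big C.
  move=> [_ AB] FC BC; split=> // g /AB []; last by right.
  by move/BC; left.
have bigA : big A by split=> // g; left.
pose deg n := exists B b,
  [/\ big B, B b, ext_rel K H x b (Posz n) & (0 < n)%N].
case: (pselect (exists n, deg n)) => [[n0 dn0]|nodeg]; last first.
  exists A => // B FB AB b Bb.
  have bB : big B by apply: bigW AB.
  have [sB BH] := FP _ FB.
  apply: (bigK B bB); split=> //.
  have [m Rm] := ext_rel_ex ext (BH b Bb).
  case: m Rm => [[|n]|n] Rm; first exact/(ext_rel0 ext).
  - by case: nodeg; exists n.+1, B, b.
  - case: nodeg; exists n.+1, B, b^-1; split=> //; first exact: subgroupV.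
    by have := ext_relV ext Rm; rewrite NegzE opprK.
have [dn minn] : deg (nat_min deg) /\ forall k, deg k -> (nat_min deg <= k)%N.
  by apply: nat_minP; exists n0.
set n := nat_min deg in dn minn; case: dn => B [b [bB Bb Rb n_gt0]].
have [FB AB] := bB; have [sB BH] := FP _ FB.
exists B => // C FC BC c Cc; have bC : big C by apply: bigW BC.
have [sC CH] := FP _ FC.
have [m Rm] := ext_rel_ex ext (CH c Cc).
have nz : Posz n != 0%R by case: (n) n_gt0.
pose q := (m %/ Posz n)%Z; pose r := (m %% Posz n)%Z.
have Rd : ext_rel K H x (c * (zexpg b q)^-1) r.
  have -> : r = (m - Posz n * q)%R.
    by rewrite {1}(divz_eq m (Posz n)) mulrC addrC addKr.
  by apply: ext_relM => //; apply: ext_relV => //; apply: ext_relZ.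
have Cd : C (c * (zexpg b q)^-1).
  by apply: sC.2 => //; apply: subgroupZ => //; apply: BC.
have r0 : r = 0%R.
  have r_ge0 : (0 <= r)%R by apply: modz_ge0.
  have r_lt : (r < Posz n)%R by apply: ltz_pmod; rewrite ltz_nat.
  case: (r) r_ge0 r_lt Rd => // -[//|k] _; rewrite ltz_nat => kn Rk.
  have /minn : deg k.+1 by exists C, (c * (zexpg b q)^-1).
  by rewrite leqNgt kn.
have Bd : B (c * (zexpg b q)^-1).
  have Kd : K (c * (zexpg b q)^-1) by apply/(ext_rel0 ext); rewrite -r0.
  by case: (AB _ (bigK C bC _ (conj Cd Kd))).
rewrite -[c](mulgVK (zexpg b q)); apply: subgroupM => //; exact: subgroupZ.
Qed.

Lemma cyclic_series_max (G : groupType) (H : set G) n :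
  cyclic_series H n -> max_condition H.
Proof.
elim=> [F [A FA] FP|K H' x k _ maxK ext _|K H' x m k _ maxK ext _ _].
- exists A => // B FB _ b Bb; have [_ B1] := FP _ FB.
  by have /= -> := B1 _ Bb; apply: subgroup1; case: (FP _ FA).
- exact: max_condition_ext ext maxK.
- exact: max_condition_ext ext maxK.
Qed.

Lemma cyclic_series_torsion (G : groupType) (H : set G) n :
  cyclic_series H n ->
  exists2 E, (0 < E)%N & forall t, H t -> torsion G t -> t ^+ E = 1.
Proof.
elim=> [|K H' x k _ [E E0 EP] ext infx|K H' x m k _ [E E0 EP] ext k0 Kx].
- by exists 1%N => // t -> _; rewrite expg1n.
- exists E => // t Ht tt; apply: EP => //; case: tt => j j0 tj.
  have [m Rm] := ext_rel_ex ext Ht.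
  have sK : subgroup K by case: ext => -[].
  have R1 : ext_rel K H' x 1 0 by apply/(ext_rel0 ext); apply: subgroup1.
  have := ext_relX ext j Rm; rewrite tj => /(ext_rel_inj ext infx R1) /esym/eqP.
  rewrite mulf_eq0 orbC; case: (j) j0 => //= j' _ /eqP m0.
  by apply/(ext_rel0 ext); rewrite -m0.
- exists (k * E)%N; first by rewrite muln_gt0 k0.
  move=> t Ht [j j0 tj]; rewrite expgnA; apply: EP; last first.
    by exists j => //; rewrite expgnAC tj expg1n.
  have [i Ri] := ext_rel_ex ext Ht.
  have sK : subgroup K by case: ext => -[].
  have [_ Kt] := ext_relX ext k Ri.
  rewrite -[t ^+ k](mulgVK (zexpg x (i * k%:Z))); apply: subgroupM => //.
  by rewrite mulrC zexpgM; apply: subgroupZ.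
Qed.

Lemma zexpg_mod (G : groupType) (y : G) p m : (0 < p)%N -> y ^+ p = 1 ->
  exists2 i, (i < p)%N & zexpg y m = y ^+ i.
Proof.
move=> p0 yp; have pz : Posz p != 0%R by case: (p) p0.
have r0 : (0 <= (m %% Posz p)%Z)%R by apply: modz_ge0.
have r_lt : ((m %% Posz p)%Z < Posz p)%R by apply: ltz_pmod; rewrite ltz_nat.
rewrite [in zexpg y m](divz_eq m (Posz p)) mulrC zexpgD zexpgM /= yp.
have -> : zexpg (1 : G) (m %/ Posz p)%Z = 1.
  by case: (m %/ Posz p)%Z => n; rewrite /= expg1n ?invg1.
rewrite mul1g; case: (m %% Posz p)%Z r0 r_lt => // i _; rewrite ltz_nat => ip.
by exists i.
Qed.

(** Modulo [p]-th powers an infinite cyclic factor has order at most [p], and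
    a finite one of order prime to [p] disappears; [E] is a product of exponents
    of the finite factors. *)
Lemma cyclic_series_cover (G : groupType) (H : set G) n :
  cyclic_series H n ->
  exists2 E, (0 < E)%N & forall p, prime p -> ~~ (p %| E) ->
  forall (Q : groupType) (pi : hom G Q), (forall y : Q, y ^+ p = 1) ->
  exists2 s : seq Q, (size s <= p ^ n)%N & forall h, H h -> pi h \in s.
Proof.
elim=> [|K H' x k _ [E E0 EP] ext infx|K H' x m k _ [E E0 EP] ext k0 Kx].
- exists 1%N => // p _ _ Q pi _; exists [:: 1] => // h ->.
  by rewrite gmulf1 inE.
- exists E => // p pp pE Q pi Qp.
  have [s sz sP] := EP p pp pE Q pi Qp.
  exists [seq r * pi x ^+ i | r <- s, i <- iota 0 p].
    by rewrite size_allpairs size_iota expnSr leq_mul.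
  move=> h Hh; have [m [_ Km]] := ext_rel_ex ext Hh.
  have [i ip xi] := zexpg_mod m (prime_gt0 pp) (Qp (pi x)).
  apply/allpairsP; exists (pi (h * (zexpg x m)^-1), i); split=> /=.
  + exact: sP.
  + by rewrite mem_iota.
  + by rewrite gmulfF hom_zexpg xi mulgVK.
- exists (k * E)%N; first by rewrite muln_gt0 k0.
  move=> p pp; rewrite Euclid_dvdM // negb_or => /andP [pk pE] Q pi Qp.
  have [s sz sP] := EP p pp pE Q pi Qp; exists s => // h Hh.
  have [i [_ Ki]] := ext_rel_ex ext Hh.
  have sK : subgroup K by case: ext => -[].
  have cop : coprime k p by rewrite coprime_sym prime_coprime.
  have [u v uv _] := egcdnP p k0.
  (* [u] inverts [k] modulo [p], so that x and x ^ (u k) have the same image *)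
  have -> : pi h = pi (h * (zexpg x i)^-1 * zexpg ((x ^+ k) ^+ u) i).
    rewrite gmulfM gmulfF !hom_zexpg !gmulfXn -expgnA mulnC uv (eqP cop).
    by rewrite addn1 expgS mulnC expgnA Qp expg1n mulg1 mulgVK.
  by apply: sP; apply: subgroupM => //; apply: subgroupZ => //; apply: subgroupX.
Qed.

(** * Cyclic series of finitely generated nilpotent groups *)

Section CommutatorIdentities.
Variable G : groupType.
Implicit Types x y z : G.

Lemma commg_mulr x y z : [~ x, y * z] = [~ x, z] * [~ x, y] ^ z.
Proof.
by rewrite !commgEl conjMg conjVg -conjgM -mulgA mulVKg.
Qed.

Lemma commg_mull x y z : [~ x * y, z] = [~ x, z] ^ y * [~ y, z].
Proof. by rewrite !commgEl /conjg !invgM !mulgA !mulgK. Qed.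

Lemma commgVr x y : [~ x, y^-1] = ([~ x, y]^-1) ^ y^-1.
Proof.
apply: (mulIg ([~ x, y] ^ y^-1)).
by rewrite -commg_mulr mulgV commg1 -conjMg mulVg conj1g.
Qed.

Lemma commgVl x y : [~ x^-1, y] = ([~ x, y]^-1) ^ x^-1.
Proof.
apply: (mulgI ([~ x, y] ^ x^-1)).
by rewrite -commg_mull mulgV comm1g -conjMg mulgV conj1g.
Qed.

End CommutatorIdentities.

Definition adjoin (G : groupType) (K : set G) (x : G) : set G :=
  [set g | exists m : int, K (g * (zexpg x m)^-1)].

Lemma adjoin_ext (G : groupType) (K : set G) x :
  normal_subgroup K -> cyclic_extension K (adjoin K x) x.
Proof.
move=> [sK nK]; split.
- split=> //; split; first by exists 0%R; rewrite /= mulgV; apply: subgroup1.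
  move=> g g' [m Km] [m' Km']; exists (m - m')%R.
  have -> : g * g'^-1 * (zexpg x (m - m'))^-1 = (g * (zexpg x m)^-1) *
      (((g' * (zexpg x m')^-1)^-1) ^ (zexpg x m')) ^ (zexpg x m)^-1.
    rewrite zexpgB /conjg !invgM !invgK !mulgA.
    by rewrite !mulgVK.
  by apply: subgroupM => //; do 2!apply: (nK); apply: subgroupV.
- by move=> k Kk; exists 0%R; rewrite /= invg1 mulg1.
- by move=> k h Kk _; apply: nK.
- by exists 1%R; rewrite /= mulgV; apply: subgroup1.
- by [].
Qed.

Lemma cyclic_series_adjoin (G : groupType) (K : set G) x n :
  normal_subgroup K -> cyclic_series K n -> exists m, cyclic_series (adjoin K x) m.
Proof.
move=> nK sK; have ext := adjoin_ext x nK.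
case: (pselect (exists2 k, (0 < k)%N & K (x ^+ k))) => [[k k0 Kk]|no].
  by exists n; apply: cyclic_series_fin ext k0 Kk.
by exists n.+1; apply: cyclic_series_inf ext _ => // k k0 Kk; apply: no; exists k.
Qed.

Lemma generates_sub (G : groupType) (S : seq G) (L : set G) :
  generates S -> subgroup L -> (forall s, s \in S -> L s) -> forall g, L g.
Proof.
move=> gS sL SL g; have [w wS <-] := gS g.
elim: w wS => [|x w IH] wS; first by rewrite big_nil; apply: subgroup1.
rewrite big_cons; apply: subgroupM => //; last first.
  by apply: IH => y yw; apply: wS; rewrite inE yw orbT.
case: (wS x _) => [|/SL //|/SL]; first by rewrite inE eqxx.
by move/(subgroupV sL); rewrite invgK.
Qed.

(** Each factor of the lower central series is finitely generated: commutators
    are bilinear modulo the next term, so the commutators of generators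
    suffice. *)
Lemma gamma_fg (G : groupType) (S : seq G) i : generates S ->
  exists2 X : seq G, (forall x, x \in X -> gamma G i.+1 x) &
  forall L, subgroup L -> gamma G i.+2 `<=` L -> (forall x, x \in X -> L x) ->
    gamma G i.+1 `<=` L.
Proof.
move=> gS; elim: i => [|i [X gX XP]].
  by exists S => // L sL _ SL x _; apply: (generates_sub gS).
exists [seq [~ x, s] | x <- X, s <- S].
  by move=> _ /allpairsP [[x s] /= [/gX gx _ ->]]; apply: gamma_comm.
move=> L sL gL XL.
have LJ a g : gamma G i.+2 a -> L a -> L (a ^ g).
  move=> ga La; have -> : a ^ g = a * [~ a, g] by rewrite commgEl mulVKg.
  by apply: subgroupM => //; apply: (gL); apply: gamma_comm.
have sg := gamma_subgroup G i.+1.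
have XV x v : x \in X -> L [~ x, v].
  move=> Xx; apply: (generates_sub (L := [set v | L [~ x, v]]) gS).
    split=> [|u w /= Lu Lw]; first by rewrite /= commg1; apply: subgroup1.
    have gx := gX x Xx.
    rewrite commg_mulr commgVr; apply: subgroupM => //.
      apply: LJ; last exact: subgroupV.
      by apply: (subgroupV (gamma_subgroup G i.+2)); apply: gamma_comm.
    by apply: LJ => //; apply: gamma_comm.
  by move=> s Ss; apply: XL; apply/allpairsP; exists (x, s).
rewrite [X in X `<=` _]gammaS; apply: generated_min => // _ [u [v [gu ->]]].
have : [set u | gamma G i.+1 u /\ forall v, L [~ u, v]] u.
  apply: (XP _ _ _ _ u gu).
  - split.
      by split=> [|w]; [apply: subgroup1 | rewrite comm1g; apply: subgroup1].
    move=> a b [ga La] [gb Lb]; split=> [|w]; first exact: sg.2.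
    rewrite commg_mull commgVl; apply: subgroupM => //.
      by apply: LJ => //; apply: gamma_comm.
    apply: LJ; last exact: subgroupV.
    by apply: (subgroupV (gamma_subgroup G i.+2)); apply: gamma_comm.
  - move=> a ga; split=> [|w]; first exact: (gamma_anti (leqnSn i)).
    by apply: (gL); apply: gamma_comm.
  - by move=> x Xx; split=> [|w]; [apply: gX | apply: XV].
by case.
Qed.

Lemma gamma_between_normal (G : groupType) i (K : set G) :
  subgroup K -> gamma G i.+2 `<=` K -> K `<=` gamma G i.+1 -> normal_subgroup K.
Proof.
move=> sK gK Kg; split=> // k g Kk.
have -> : k ^ g = k * [~ k, g] by rewrite commgEl mulVKg.
by apply: subgroupM => //; apply: (gK); apply: gamma_comm; apply: Kg.
Qed.

(** Every subgroup between two consecutive terms of the lower central series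
    is normal, so the generators of the factor can be adjoined one by one. *)
Lemma cyclic_series_gamma (G : groupType) (S : seq G) i n :
  generates S -> cyclic_series (gamma G i.+2) n ->
  exists m, cyclic_series (gamma G i.+1) m.
Proof.
move=> gS csn; have [X gX XP] := gamma_fg i gS.
suff: forall Y : seq G, {subset Y <= X} -> exists K m,
    [/\ cyclic_series K m, subgroup K, gamma G i.+2 `<=` K,
        K `<=` gamma G i.+1 & forall x, x \in Y -> K x].
  case/(_ X) => // K [m [csK sK gK Kg XK]]; exists m.
  by suff -> : gamma G i.+1 = K by []; apply/seteqP; split=> //; apply: XP.
elim=> [|x Y IH] YX.
  exists (gamma G i.+2), n; split=> //; first exact: gamma_subgroup.
  exact: (gamma_anti (leqnSn i)).
case: IH => [y Yy|K [m [csK sK gK Kg YK]]].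
  by apply: YX; rewrite inE Yy orbT.
have nK := gamma_between_normal sK gK Kg.
have [m' csK'] := cyclic_series_adjoin x nK csK.
have [[_ sK'] KK' _ K'x _] := adjoin_ext x nK.
exists (adjoin K x), m'; split=> //.
- exact: subset_trans KK'.
- move=> g [k Kgk]; rewrite -[g](mulgVK (zexpg x k)).
  have sg := gamma_subgroup G i.+1.
  apply: subgroupM => //; first exact: Kg.
  by apply: subgroupZ => //; apply: gX; apply: YX; rewrite inE eqxx.
- by move=> y; rewrite inE => /orP [/eqP -> //|/YK/KK'].
Qed.

Lemma nilpotent_cyclic_series (G : groupType) :
  finitely_generated G -> nilpotent_group G -> exists n, cyclic_series [set: G] n.
Proof.
move=> [S gS] [c gc].
suff: forall i, (i <= c)%N -> exists n, cyclic_series (gamma G (c - i).+1) n.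
  by move/(_ c (leqnn c)); rewrite subnn.
elim=> [|i IH] ic; first by exists 0%N; rewrite subn0 gc; apply: cyclic_series1.
have [n] := IH (ltnW ic); rewrite -[(c - i)%N](@prednK) ?subn_gt0 // -subnS.
exact: cyclic_series_gamma.
Qed.

(** * Quotients and torsion *)

Lemma quotient_hom (G : groupType) (A : set G) :
  exists pi : hom G (Defs.quotient_group A),
    surjective pi /\ forall x, pi x = 1 <-> normal_closure A x.
Proof.
have [pi piE] := hom_of (@quotient_projM G A); exists pi; split.
  by move=> y; have [x <-] := quotient_proj_surj y; exists x.
by move=> x; rewrite piE; apply: quotient_projP.
Qed.

Lemma normal_quotient_hom (G : groupType) (K : set G) :
  normal_subgroup K -> exists (Q : groupType) (pi : hom G Q),
    surjective pi /\ forall x, pi x = 1 <-> K x.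
Proof.
move=> nK; have [pi [spi kpi]] := quotient_hom K.
exists (Defs.quotient_group K), pi; split=> // x.
by rewrite -[X in _ <-> X x](normal_closure_id nK).
Qed.

Lemma factor_hom (G Q P : groupType) (pi : hom G Q) (phi : hom G P) :
  surjective pi -> (forall x, pi x = 1 -> phi x = 1) ->
  exists psi : hom Q P, forall x, psi (pi x) = phi x.
Proof.
move=> spi ker; pose s y := projT1 (cid (spi y)).
have sK y : pi (s y) = y by rewrite /s; case: cid.
have wd x y : pi x = pi y -> phi x = phi y.
  move=> xy; apply/divg1_eq; rewrite -gmulfF; apply: ker.
  by rewrite gmulfF xy mulgV.
have sM : {morph phi \o s : x y / x * y}.
  by move=> x y /=; rewrite -gmulfM; apply: wd; rewrite gmulfM !sK.
have [psi psiE] := hom_of sM.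
by exists psi => x; rewrite psiE /=; apply: wd; rewrite sK.
Qed.

Lemma surj_nilpotent (G Q : groupType) (pi : hom G Q) c :
  surjective pi -> gamma G c.+1 = [set 1] -> gamma Q c.+1 = [set 1].
Proof.
move=> spi gc; apply/seteqP; split=> [y|_ ->]; last first.
  exact: (subgroup1 (gamma_subgroup Q _)).
by case/(surj_gamma spi) => x; rewrite gc => -> <-; rewrite /= gmulf1.
Qed.

Definition central (G : groupType) (z : G) : Prop := forall y, commute z y.

Definition torsion_free (G : groupType) : Prop := forall g, torsion G g -> g = 1.

Lemma commg_expl (G : groupType) (t y : G) k :
  commute t [~ t, y] -> [~ t ^+ k, y] = [~ t, y] ^+ k.
Proof.
move=> com; elim: k => [|k IH]; first exact: comm1g.
rewrite expgSr commg_mull IH expgSr; congr (_ * _).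
apply/conjg_fixP/commgP/commute_sym; exact: commuteX.
Qed.

Lemma gamma_descent (G : groupType) (P : nat -> Prop) :
  nilpotent_group G -> (forall i, gamma G i.+1 = [set 1] -> P i) ->
  (forall i, P i.+1 -> P i) -> P 0%N.
Proof.
move=> [c gc] Pc PS; suff: forall i, (i <= c)%N -> P (c - i)%N.
  by move/(_ c (leqnn c)); rewrite subnn.
elim=> [|i IH] ic; first by rewrite subn0; apply: Pc.
by apply: PS; rewrite subnS prednK ?subn_gt0 //; apply/IH/ltnW.
Qed.

(** If a torsion element [t] commutes with the next term of the lower central
    series, then [~ t, y] ^+ k = [~ t ^+ k, y] for y in the current one, so
    that [~ t, y] is torsion too; descending along the series, the torsion
    elements become central. *)
Lemma nilpotent_torsion_free (G : groupType) : nilpotent_group G ->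
  (forall z : G, central z -> torsion G z -> z = 1) -> torsion_free G.
Proof.
move=> nilG torZ.
suff [_ tor1] : (forall t y : G, torsion G t -> gamma G 1 y -> commute t y) /\
    (forall t : G, torsion G t -> gamma G 1 t -> t = 1).
  by move=> t tt; apply: tor1.
pose P i := (forall t y : G, torsion G t -> gamma G i.+1 y -> commute t y) /\
  (forall t : G, torsion G t -> gamma G i.+1 t -> t = 1).
apply: (gamma_descent (P := P)) nilG _ _ => [i gi|i [comm tor]].
  by split=> [t y _|t _]; rewrite gi => ->; [apply: commute1|].
have torC t y : torsion G t -> gamma G i.+2 [~ t, y] -> commute t y.
  move=> tt gty; apply/commgP/eqP; apply: tor => //.
  case: (tt) => k k0 tk; exists k => //; rewrite -commg_expl ?tk ?comm1g //.
  exact: comm.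
split=> [t y tt gy|t tt gt].
  apply: torC => //; rewrite -invgR.
  by apply: (subgroupV (gamma_subgroup G _)); apply: gamma_comm.
by apply: torZ => // y; apply: torC => //; apply: gamma_comm.
Qed.

(** As in the previous proof, [~ g, y] ^+ k = [~ g ^+ k, y] = 1 as soon as [g]
    commutes with the next term of the lower central series. *)
Lemma torsion_free_central (G : groupType) (g : G) k :
  nilpotent_group G -> torsion_free G -> (0 < k)%N ->
  central (g ^+ k) -> central g.
Proof.
move=> nilG tf k0 cgk.
suff cg : forall y, gamma G 1 y -> commute g y by move=> y; apply: cg.
pose P i := forall y, gamma G i.+1 y -> commute g y.
apply: (gamma_descent (P := P)) nilG _ _ => [i gi y|i comm y gy].
  by rewrite gi => ->; apply: commute1.
apply/commgP/eqP; apply: tf; exists k => //.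
rewrite -commg_expl; first exact/eqP/commgP.
apply: comm; rewrite -invgR.
by apply: (subgroupV (gamma_subgroup G _)); apply: gamma_comm.
Qed.

Lemma mul_torsion_normal (G : groupType) (A B : set G) :
  normal_subgroup A -> normal_subgroup B -> A `<=` torsion G ->
  B `<=` torsion G ->
  let AB := [set g | exists a b, [/\ A a, B b & g = a * b]] in
  normal_subgroup AB /\ AB `<=` torsion G.
Proof.
move=> [sA nA] [sB nB] tA tB; split.
  split; first split.
  - by exists 1, 1; split; [apply: subgroup1 | apply: subgroup1 | rewrite mulg1].
  - move=> _ _ [a [b [Aa Bb ->]]] [a' [b' [Aa' Bb' ->]]].
    exists (a * (a'^-1) ^ (b * b'^-1)^-1), (b * b'^-1); split.
    + by apply: subgroupM => //; apply: nA; apply: subgroupV.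
    + exact: sB.2.
    + by rewrite /conjg !invgM !invgK !mulgA !(mulgVK, mulgK).
  - move=> _ y [a [b [Aa Bb ->]]]; exists (a ^ y), (b ^ y).
    by rewrite conjMg; split; [apply: nA | apply: nB |].
move=> _ [a [b [Aa Bb ->]]]; have [k k0 bk] := tB b Bb.
have : A ((a * b) ^+ k * b ^- k).
  elim: (k) => [|j IH]; first by rewrite /= !expg0 mulgV; apply: subgroup1.
  have -> : (a * b) ^+ j.+1 * b ^- j.+1 =
      a * ((a * b) ^+ j * b ^- j) ^ b^-1.
    by rewrite expgS [b ^+ j.+1]expgS invgM /conjg invgK !mulgA.
  by apply: subgroupM => //; apply: nA.
rewrite bk invg1 mulg1 => /tA [j j0 abj]; exists (k * j)%N.
  by rewrite muln_gt0 k0.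
by rewrite expgnA.
Qed.

Lemma adjoin_hom (G Q : groupType) (pi : hom G Q) (K : set G) x g :
  (forall u, pi u = 1 <-> K u) ->
  adjoin K x g <-> exists m, pi g = zexpg (pi x) m.
Proof.
move=> kpi; split=> -[m Km]; exists m.
  by apply/divg1_eq; rewrite -hom_zexpg -gmulfF; apply/kpi.
by apply/kpi; rewrite gmulfF hom_zexpg Km mulgV.
Qed.

Lemma adjoin_normal (G Q : groupType) (pi : hom G Q) (K : set G) x :
  normal_subgroup K -> surjective pi -> (forall u, pi u = 1 <-> K u) ->
  central (pi x) -> normal_subgroup (adjoin K x).
Proof.
move=> nK spi kpi cx; split; first by case: (adjoin_ext x nK) => -[].
move=> g y /(adjoin_hom _ _ kpi) [m gm]; apply/(adjoin_hom _ _ kpi); exists m.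
rewrite gmulfJ gm zexpg_conj; congr (zexpg _ _).
by apply/conjg_fixP/commgP.
Qed.

(** Let [T] be the union of all normal subgroups that consist of torsion
    elements. It is a subgroup because products of such subgroups are again
    such, and a central torsion element modulo [T] lies in [T]; hence the
    quotient by [T] is torsion free, and every torsion element is in [T]. *)
Lemma torsion_normal (G : groupType) :
  nilpotent_group G -> normal_subgroup (torsion G).
Proof.
move=> nilG.
pose T := [set g | exists A, [/\ normal_subgroup A, A `<=` torsion G & A g]].
have nT : normal_subgroup T.
  split; first split.
  - exists [set 1]; split=> //; first exact: normal_subgroup1.
    by move=> _ ->; exists 1%N.
  - move=> x y [A [nA tA Ax]] [B [nB tB By]].
    have [nAB tAB] := mul_torsion_normal nA nB tA tB.
    exists [set g | exists a b, [/\ A a, B b & g = a * b]]; split=> //.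
    by exists x, y^-1; split=> //; apply: subgroupV => //; case: nB.
  - by move=> x y [A [nA tA Ax]]; exists A; split=> //; apply: nA.2.
have tT : T `<=` torsion G by move=> x [A [_ tA Ax]]; apply: tA.
have [Q [pi [spi kpi]]] := normal_quotient_hom nT.
have tfQ : torsion_free Q.
  apply: nilpotent_torsion_free.
    by case: nilG => c gc; exists c; apply: surj_nilpotent spi gc.
  move=> z cz [k k0 zk]; have [x xz] := spi z; subst z.
  apply/kpi; exists (adjoin T x); split.
  - exact: adjoin_normal kpi cz.
  - move=> g /(adjoin_hom _ _ kpi) [m gm].
    have /tT [j j0 gj] : T (g ^+ k).
      apply/kpi; rewrite gmulfXn gm.
      by rewrite -[LHS]/(zexpg _ (Posz k)) -zexpgM mulrC zexpgM /= zk;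
         case: (m) => n /=; rewrite expg1n ?invg1.
    by exists (k * j)%N; [rewrite muln_gt0 k0 | rewrite expgnA].
  - by case: (adjoin_ext x nT).
suff -> : torsion G = T by [].
apply/seteqP; split=> // t [k k0 tk]; apply/kpi; apply: tfQ; exists k => //.
by rewrite -gmulfXn tk gmulf1.
Qed.

Lemma mod_torsion_hom (N : groupType) : nilpotent_group N ->
  exists pi : hom N (mod_torsion N),
    surjective pi /\ forall x, pi x = 1 <-> torsion N x.
Proof.
move=> nilN; have [pi [spi kpi]] := quotient_hom (torsion N).
by exists pi; split=> // x; rewrite kpi normal_closure_id //; apply: torsion_normal.
Qed.

Lemma mod_torsion_free (N : groupType) :
  nilpotent_group N -> torsion_free (mod_torsion N).
Proof.
move=> nilN g [k k0 gk]; have [pi [spi kpi]] := mod_torsion_hom nilN.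
have [x xg] := spi g; subst g; move: gk; rewrite -gmulfXn => /kpi [j j0 xj].
by apply/kpi; exists (k * j)%N; [rewrite muln_gt0 k0 | rewrite expgnA].
Qed.

(** * Polynomial functions of bounded weighted degree *)

Section Polynomials.
Variable G : groupType.
Implicit Types (f g F : G -> int) (K H : set G) (u v x y k h : G).

Definition Delta u f : G -> int := fun x => (f (u * x)%g - f x)%R.

(** Polynomial functions on [K] of weighted degree less than [d]: an element of
    [gamma G w] has weight [w], and taking the difference along it lowers the
    degree by [w]. Counting weights, and not just differences, makes
    conjugation by any element of [G] act unipotently on these functions. *)
Inductive poly_lt K : nat -> (G -> int) -> Prop :=
| poly_lt0 f : (forall k, K k -> f k = 0%R) -> poly_lt K 0 f
| poly_ltS d f :
    (forall w u, K u -> gamma G w.+1 u -> poly_lt K (d - w) (Delta u f)) ->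
    poly_lt K d.+1 f.

Lemma poly_lt0E K f : poly_lt K 0 f -> forall k, K k -> f k = 0%R.
Proof. by move=> H; inversion H. Qed.

Lemma poly_ltSE K d f w u :
  poly_lt K d.+1 f -> K u -> gamma G w.+1 u -> poly_lt K (d - w) (Delta u f).
Proof. by move=> H; inversion H; subst; auto. Qed.

Lemma poly_zero K d f : subgroup K -> (forall k, K k -> f k = 0%R) -> poly_lt K d f.
Proof.
move=> sK; elim/ltn_ind: d f => -[|d] IH f f0; first exact: poly_lt0.
constructor=> w u Ku _; apply: IH; first by rewrite ltnS leq_subr.
by move=> k Kk; rewrite /Delta !f0 ?subrr //; apply: subgroupM.
Qed.

Lemma poly_ext K d f g : subgroup K ->
  (forall k, K k -> f k = g k) -> poly_lt K d f -> poly_lt K d g.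
Proof.
move=> sK fg pf; elim: pf g fg => {d f} [f f0|d f pf IH] g fg.
  by apply: poly_lt0 => k Kk; rewrite -fg ?f0.
constructor=> w u Ku gu; apply: IH gu _ _ => // k Kk.
by rewrite /Delta !fg //; apply: subgroupM.
Qed.

Lemma poly_mono K d e f : subgroup K ->
  (d <= e)%N -> poly_lt K d f -> poly_lt K e f.
Proof.
move=> sK de pf; elim: pf e de => {d f} [f f0|d f pf IH] e de.
  exact: poly_zero.
case: e de => // e de; constructor=> w u Ku gu; apply: (IH w u Ku gu).
exact: leq_sub2r.
Qed.

Lemma poly_add K d f g : poly_lt K d f -> poly_lt K d g ->
  poly_lt K d (fun x => (f x + g x)%R).
Proof.
move=> pf; elim: pf g => {d f} [f f0|d f pf IH] g pg.
  by apply: poly_lt0 => k Kk; rewrite f0 // (poly_lt0E pg) // addr0.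
constructor=> w u Ku gu; have := IH w u Ku gu _ (poly_ltSE pg Ku gu).
congr poly_lt; apply/funext => k.
by rewrite /Delta opprD addrACA.
Qed.

Lemma poly_Delta K d f w u : subgroup K -> poly_lt K d f ->
  K u -> gamma G w.+1 u -> poly_lt K (d.-1 - w) (Delta u f).
Proof.
move=> sK; case: d => [|d] pf Ku gu; last exact: poly_ltSE.
apply: poly_zero => // k Kk; have f0 := poly_lt0E pf.
by rewrite /Delta !f0 ?subrr //; apply: subgroupM.
Qed.

Lemma poly_conj K d f y : (forall k, K k -> K (k ^ y)) ->
  poly_lt K d f -> poly_lt K d (fun k => f (k ^ y)).
Proof.
move=> nK pf; elim: pf => {d f} [f f0|d f pf IH].
  by apply: poly_lt0 => k /nK; apply: f0.
constructor=> w u Ku gu.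
have := IH w (u ^ y) (nK u Ku) ((gamma_normal G w.+1).2 u y gu).
by congr poly_lt; apply/funext => k; rewrite /Delta conjMg.
Qed.

(** Conjugation by [y] acts unipotently on functions of bounded weighted
    degree: on the top-degree part, it replaces each [u] by [u * [~ u, y]],
    and the commutator has larger weight. *)
Lemma poly_conj_sub K d f y : subgroup K -> (forall k, K k -> K (k ^ y)) ->
  poly_lt K d f -> poly_lt K d.-1 (fun k => (f (k ^ y)%g - f k)%R).
Proof.
move=> sK nK; elim/ltn_ind: d f => -[|d] IH f pf.
  have f0 := poly_lt0E pf; apply: poly_lt0 => k Kk.
  by rewrite !f0 ?subrr //; apply: nK.
case: d IH pf => [|d] IH pf; rewrite /=.
  apply: poly_lt0 => k Kk.
  have fc u : K u -> f u = f 1.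
    move=> Ku; have /poly_lt0E := poly_ltSE (w := 0) pf Ku I.
    move/(_ 1 (subgroup1 sK)); rewrite /Delta mulg1 => /eqP.
    by rewrite subr_eq0 => /eqP.
  by rewrite (fc k) ?(fc (k ^ y)%g) ?subrr //; apply: nK.
constructor=> w u Ku gu; set v := [~ u, y].
have Kv : K v.
  by rewrite /v commgEl; apply: subgroupM; [|apply: subgroupV|apply: nK].
have gv : gamma G w.+2 v by apply: gamma_comm.
have pu := poly_ltSE pf Ku gu; have pv := poly_ltSE pf Kv gv.
rewrite subSS in pv.
have pvu : poly_lt K (d - w) (Delta v (Delta u f)).
  by apply: poly_mono (poly_Delta sK pu Kv gv) => //; lia.
have p1 : poly_lt K (d - w) (fun k => (Delta u f (k ^ y)%g - Delta u f k)%R).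
  have := IH (d.+1 - w)%N _ _ pu; rewrite ltnS leq_subr => /(_ isT).
  by rewrite -subn1 -subnDA addn1 subSS.
have := poly_add p1 (poly_conj nK (poly_add pvu pv)).
apply: poly_ext => // k Kk; rewrite /Delta.
have -> : (u * k) ^ y = u * (v * k ^ y).
  by rewrite conjMg [RHS]mulgA /v commgEl mulVKg.
set a := f (u * (v * _)); set b := f (u * k ^ y); set b' := f (k ^ y).
set e := f (v * _); set b1 := f (u * k); set b2 := f k.
rewrite !opprB !addrA; lia.
Qed.

Section Lift.
Variables (K H : set G) (x : G) (c : nat).
Hypothesis ext : cyclic_extension K H x.
Hypothesis infx : forall j, (0 < j)%N -> ~ K (x ^+ j).
Hypothesis gc : gamma G c.+1 = [set 1].
Hypothesis c_gt0 : (0 < c)%N.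

Let sK : subgroup K. Proof. by case: ext => -[]. Qed.
Let sH : subgroup H. Proof. by case: ext => -[]. Qed.

Definition lifts f F :=
  forall h n, ext_rel K H x h n -> F h = f (h * (zexpg x n)^-1).

(* elements of weight greater than [c] are trivial *)
Let poly_heavy d F w u : (c <= w)%N -> gamma G w.+1 u -> poly_lt H d (Delta u F).
Proof.
move=> cw /(gamma_anti cw); rewrite gc => ->; apply: poly_zero => // k _.
by rewrite /Delta mul1g subrr.
Qed.

(** The function [F] (k x^n) = f k on K<x>: translating by an element of
    weight at least one lowers the degree of [f], and weights are at most
    [c], so that the weighted degree grows at most by the factor [c]. *)
Lemma poly_lift d f F : poly_lt K d f -> lifts f F -> poly_lt H (c * d) F.
Proof.
elim: d f F => [|d IH] f F pf fF.
  rewrite muln0; apply: poly_lt0 => h Hh; have [n Rn] := ext_rel_ex ext Hh.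
  by rewrite (fF h n) //; apply: (poly_lt0E pf); case: Rn.
rewrite mulnS -(prednK c_gt0) addSn prednK //; constructor=> w u Hu gu.
have [cw|wc] := leqP c w; first exact: poly_heavy gu.
have [m Rm] := ext_rel_ex ext Hu.
pose y := (zexpg x m)^-1; pose k0 := u * y.
have Kk0 : K k0 by case: Rm.
have nK k : K k -> K (k ^ y).
  move=> Kk; case: ext => _ _ + Hx _; apply=> //.
  by apply: subgroupV => //; apply: subgroupZ.
(* translation of [F] by [u] amounts to translation of [f] by [k0], followed
   by conjugation by a power of [x] *)
pose f' k := (Delta k0 f (k ^ y)%g + (f (k ^ y)%g - f k))%R.
have pf' : poly_lt K d f'.
  apply: poly_add; last exact: poly_conj_sub pf.
  by apply: poly_conj => //; have := poly_ltSE (w := 0) pf Kk0 I; rewrite subn0.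
apply: (@poly_mono _ (c * d)) => //.
  by rewrite addnC -addnBA ?leq_addr // -ltnS prednK.
apply: IH pf' _ => h n Rn; rewrite /f' /Delta addrA subrK.
rewrite (fF h n) // (fF (u * h) (m + n)%R); last exact: ext_relM.
congr (f _ - _)%R; rewrite zexpgD /k0 /y /conjg !invgM !invgK !mulgA.
by rewrite mulgVK.
Qed.

Let coord h : int := xget 0%R [set m | ext_rel K H x h m].

Let coordE h m : ext_rel K H x h m -> coord h = m.
Proof.
move=> Rm; apply: (ext_rel_inj ext infx) (Rm).
by rewrite /coord; case: xgetP => [n _ Rn //|no]; case: (no m Rm).
Qed.

(** The projection of [H] onto [H / K] is a homomorphism to the integers, so
    its differences are constant. *)
Lemma poly_coord : poly_lt H c.+1 coord.
Proof.
constructor=> w u Hu gu; have [cw|wc] := leqP c w; first exact: poly_heavy gu.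
have [m Rm] := ext_rel_ex ext Hu.
have D h : H h -> Delta u coord h = m.
  move=> Hh; have [n Rn] := ext_rel_ex ext Hh.
  by rewrite /Delta (coordE Rn) (coordE (ext_relM ext Rm Rn)) addrK.
apply: (@poly_mono _ 1) => //; first by rewrite subn_gt0.
constructor=> w' u' Hu' _; apply: poly_zero => // h Hh.
by rewrite /(Delta u') !D ?subrr //; apply: subgroupM.
Qed.

Definition separated L := forall z, L z -> z <> 1 ->
  exists d f, poly_lt L d f /\ f z <> f 1.

Lemma separated_ext : separated K -> separated H.
Proof.
move=> sepK z Hz z1; have [m Rm] := ext_rel_ex ext Hz.
have R1 : ext_rel K H x 1 0 by apply/(ext_rel0 ext); apply: subgroup1.
case: (eqVneq m 0%R) Rm => [->|m0] Rm; last first.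
  exists c.+1, coord; split; first exact: poly_coord.
  by rewrite (coordE Rm) (coordE R1); apply/eqP.
have Kz : K z by apply/(ext_rel0 ext).
have [d [f [pf fz]]] := sepK z Kz z1.
pose F h := f (h * (zexpg x (coord h))^-1).
have fF : lifts f F by move=> h n Rn; rewrite /F (coordE Rn).
exists (c * d)%N, F; split; first exact: poly_lift pf fF.
by rewrite (fF z 0%R) // (fF 1 0%R) //= invg1 !mulg1.
Qed.

End Lift.
End Polynomials.

(** * Separation of points by polynomial functions *)

Lemma nilpotent_center (G : groupType) (y : G) :
  nilpotent_group G -> y <> 1 -> exists2 z : G, central z & z <> 1.
Proof.
move=> nilG y1; pose P i := forall y, gamma G i.+1 y -> y <> 1 ->
  exists2 z : G, central z & z <> 1.
suff P0 : P 0%N by apply: (P0 y).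
apply: gamma_descent nilG _ _ => [i gi u|i IH u gu u1]; first by rewrite gi => ->.
case: (pselect (central u)) => [cu|/existsNP [v uv]]; first by exists u.
apply: (IH [~ u, v]); first exact: gamma_comm.
by move/eqP/commgP.
Qed.

(** A common power of two commuting elements of a torsion-free group comes
    from a common root, by the Euclidean algorithm. *)
Lemma common_root (G : groupType) (a b : G) (k m : int) :
  torsion_free G -> commute a b -> k != 0%R -> zexpg a k = zexpg b m ->
  exists i j k' m' : int, let y := zexpg a i * zexpg b j in
    zexpg y k' = b /\ zexpg y m' = a.
Proof.
move=> tf ab k0 abk; have [u [v uv]] := Bezoutz k m.
set D := gcdz k m in uv.
have D0 : D != 0%R by rewrite gcdz_eq0 negb_and k0.
have /dvdzP [k' kE] : (D %| k)%Z by apply: dvdz_gcdl.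
have /dvdzP [m' mE] : (D %| m)%Z by apply: dvdz_gcdr.
have uv1 : (u * k' + v * m')%R = 1%R.
  apply: (mulIf D0); rewrite mulrDl mul1r -!mulrA -kE -mE; exact: uv.
have ab' : zexpg a k' = zexpg b m'.
  apply: divg1_eq; rewrite -zexpgN.
  have com : commute (zexpg a k') (zexpg b (- m')).
    by apply: commute_zexpg; apply/commute_sym/commute_zexpg/commute_sym.
  have torD : zexpg (zexpg a k' * zexpg b (- m')) D = 1.
    by rewrite zexpgMn // -!zexpgM mulNr -kE -mE abk zexpgN mulgV.
  apply: tf; exists `|D|%N; first by rewrite absz_gt0.
  case: (D) torD => n E; first exact: E.
  by apply: invg_inj; rewrite invg1; exact: E.
have com i j : commute (zexpg a i) (zexpg b j).
  by apply: commute_zexpg; apply/commute_sym/commute_zexpg/commute_sym.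
have swap (c : G) i j : zexpg (zexpg c i) j = zexpg (zexpg c j) i.
  by rewrite -!zexpgM mulrC.
exists v, u, k', m'; rewrite /= !zexpgMn //; split.
- rewrite (swap a) ab' -!zexpgM -zexpgD.
  have -> : (m' * v + u * k')%R = 1%R by rewrite addrC [(m' * v)%R]mulrC.
  by [].
- rewrite (swap b) -ab' -!zexpgM -zexpgD.
  have -> : (v * m' + k' * u)%R = 1%R by rewrite addrC [(k' * u)%R]mulrC.
  by [].
Qed.

Definition isolated (G : groupType) (K : set G) : Prop :=
  forall g k, (0 < k)%N -> K (g ^+ k) -> K g.

(** A maximal cyclic subgroup of the centre of the torsion-free group [G / K]
    yields the next term of a central series with infinite cyclic factors. *)
Lemma isolated_step (G : groupType) (K : set G) :
  nilpotent_group G -> max_condition [set: G] -> normal_subgroup K ->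
  isolated K -> (exists g, ~ K g) ->
  exists x, [/\ normal_subgroup (adjoin K x), isolated (adjoin K x) & ~ K x].
Proof.
move=> nilG maxG nK iK [g0 Kg0].
have [Q [pi [spi kpi]]] := normal_quotient_hom nK.
have nilQ : nilpotent_group Q.
  by case: nilG => c gc; exists c; apply: surj_nilpotent spi gc.
have tfQ : torsion_free Q.
  move=> q [k k0 qk]; have [g gq] := spi q; subst q.
  by apply/kpi; apply: (iK g k) => //; apply/kpi; rewrite gmulfXn.
(* modulo [K], a maximal one of these is an infinite cyclic subgroup of the
   centre that contains all roots of its elements *)
pose F := [set A | exists y, [/\ ~ K y, central (pi y) & A = adjoin K y]].
have [|A [y [_ cy ->]]|_ [x [Kx cx ->]] maxx] := maxG F.
- have pig0 : pi g0 <> 1 by move/(kpi g0).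
  have [z cz z1] := nilpotent_center nilQ pig0.
  have [y yz] := spi z; subst z; exists (adjoin K y), y; split=> //.
  by move/(kpi y).
- by split=> //; case: (adjoin_normal nK spi kpi cy).
exists x; split=> //; first exact: adjoin_normal spi kpi cx.
move=> g k k0 /(adjoin_hom _ _ kpi) [m gm].
have cg : central (pi g).
  apply: (torsion_free_central nilQ tfQ k0) => y.
  by rewrite -gmulfXn gm; apply/commute_sym/commute_zexpg/commute_sym/cx.
have gk : zexpg (pi g) (Posz k) = zexpg (pi x) m by rewrite /= -gmulfXn.
have kz : Posz k != 0%R by case: (k) k0.
have [i [j [k' [m' [yx yg]]]]] := common_root tfQ (cg (pi x)) kz gk.
pose y := zexpg g i * zexpg x j.
have piy : pi y = zexpg (pi g) i * zexpg (pi x) j by rewrite gmulfM !hom_zexpg.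
rewrite -piy in yx yg.
apply: (maxx (adjoin K y)).
- exists y; split=> //.
    move=> /(kpi y) y1; apply: Kx; apply/kpi; rewrite -yx y1.
    by case: (k') => n /=; rewrite expg1n ?invg1.
  move=> q; rewrite piy; apply: commute_sym; apply: commuteM.
    exact/commute_zexpg/commute_sym.
  exact/commute_zexpg/commute_sym.
- move=> h /(adjoin_hom _ _ kpi) [n hn]; apply/(adjoin_hom _ _ kpi).
  by exists (k' * n)%R; rewrite zexpgM yx.
- by apply/(adjoin_hom _ _ kpi); exists m'.
Qed.

(** Starting from the trivial group, isolated normal subgroups on which
    polynomial functions separate every element from 1 can be enlarged by an
    infinite cyclic factor until they exhaust [G]. *)
Lemma torsion_free_separated (G : groupType) :
  nilpotent_group G -> torsion_free G -> max_condition [set: G] ->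
  separated [set: G].
Proof.
move=> nilG tf maxG.
pose F := [set K : set G | [/\ normal_subgroup K, isolated K & separated K]].
have [|A [[]]|K [nK iK sepK] maxK] := maxG F.
- exists [set 1]; split; first exact: normal_subgroup1.
  + by move=> g k k0 gk; apply: tf; exists k.
  + by move=> z /= ->.
- by split.
suff -> : [set: G] = K by [].
apply/seteqP; split=> // g _; apply: contrapT => Kg.
have [|x [nH iH Kx]] := isolated_step nilG maxG nK iK; first by exists g.
have ext := adjoin_ext x nK; have [_ KH _ Hx _] := ext.
have sepH : separated (adjoin K x).
  have [c gc] := nilG; have gc1 : gamma G c.+2 = [set 1].
    apply/seteqP; split; first by rewrite -gc; apply: gamma_anti.
    by move=> _ ->; apply: (subgroup1 (gamma_subgroup G _)).
  by apply: (separated_ext ext _ gc1) => // j j0 /(iK x j j0).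
by apply: Kx; apply: (maxK (adjoin K x)).
Qed.

(** * Quotients of prime exponent *)

Lemma newton (G : groupType) (g x : G) (f : G -> int) n :
  f (g ^+ n * x) = (\sum_(i < n.+1) iter i (Delta g) f x *+ 'C(n, i))%R.
Proof.
elim: n f => [|n IH] f; first by rewrite big_ord1 expg0 mul1g bin0.
have -> : f (g ^+ n.+1 * x) = (f (g ^+ n * x)%g + Delta g f (g ^+ n * x)%g)%R.
  by rewrite /Delta addrC subrK expgS mulgA.
rewrite !IH [RHS]big_ord_recl bin0.
have -> : (\sum_(i < n.+1) iter i (Delta g) f x *+ 'C(n, i) =
    f x + \sum_(i < n.+1) iter i.+1 (Delta g) f x *+ 'C(n, i.+1))%R.
  rewrite big_ord_recl bin0; congr (_ + _)%R.
  by rewrite [RHS]big_ord_recr /= bin_small // mulr0n addr0.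
rewrite -addrA -big_split /=; congr (_ + _)%R; apply: eq_bigr => i _.
by rewrite -iterS iterSr binS mulrnDr.
Qed.

Lemma poly_iter_Delta (G : groupType) (g x : G) f d n :
  poly_lt [set: G] d f -> (d <= n)%N -> iter n (Delta g) f x = 0%R.
Proof.
elim: n d f => [|n IH] d f pf dn.
  by move: dn pf; rewrite leqn0 => /eqP -> /poly_lt0E; apply.
rewrite iterSr; apply: (IH d.-1); last by lia.
by have := poly_Delta (w := 0) (@subgroupT G) pf I I; rewrite subn0.
Qed.

(** In Newton's expansion of [f] along the powers of [g], the middle binomial
    coefficients vanish modulo [p] and the last difference vanishes when the
    degree of [f] is less than [p]. *)
Lemma poly_expp (G : groupType) (g x : G) f d p : prime p ->
  poly_lt [set: G] d f -> (d <= p)%N ->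
  (Posz p %| (f (g ^+ p * x)%g - f x)%R)%Z.
Proof.
move=> pp pf dp; rewrite newton big_ord_recl /= bin0 mulr1n addrAC subrr add0r.
apply: (big_ind (fun v => (Posz p %| v)%Z)) => [||i _]; first exact: dvdz0.
  by move=> a b; apply: rpredD.
rewrite /bump leq0n add1n; have [ip|ip] := ltnP i.+1 p.
  by rewrite -mulr_natr dvdz_mull // natz; apply: prime_dvd_bin.
by rewrite -iterS (poly_iter_Delta g x pf) ?mul0rn ?dvdz0 //; lia.
Qed.

Definition expp_subgroup (G : groupType) p : set G :=
  normal_closure [set g | exists h : G, g = h ^+ p].

Lemma poly_expp_subgroup (G : groupType) (z : G) f d p : prime p ->
  poly_lt [set: G] d f -> (d <= p)%N -> expp_subgroup p z ->
  (Posz p %| (f z - f 1%g)%R)%Z.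
Proof.
move=> pp pf dp zp.
(* a normal subgroup, unlike the left or right periods of [f] modulo [p] *)
pose U := [set u | forall x y, (Posz p %| (f (y * u * x)%g - f (y * x)%g)%R)%Z].
have nU : normal_subgroup U.
  split; first split.
  - by move=> x y; rewrite mulg1 subrr dvdz0.
  - move=> u v Uu Uv x y.
    have := Uu (v^-1 * x) y; have := Uv (v^-1 * x) y.
    rewrite !mulgA mulgK => A B; have := rpredB B A.
    by rewrite opprB addrA subrK.
  - move=> u g Uu x y; have := Uu (g * x) (y * g^-1).
    by rewrite /conjg !mulgA mulgVK.
have /(_ 1 1) : U z.
  apply: zp; split=> // _ [h ->] x y.
  have -> : y * h ^+ p * x = (h ^ y^-1) ^+ p * (y * x).
    by rewrite -conjXg /conjg invgK !mulgA mulgVK.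
  exact: poly_expp pf dp.
by rewrite !mulg1 mul1g.
Qed.

Lemma finite_group_of (Q : groupType) (s : seq Q) : (forall q, q \in s) ->
  exists (P : finGroupType) (phi : hom Q P),
    [/\ surjective phi, (forall q, phi q = 1 -> q = 1) & (#|P| <= size s)%N].
Proof.
move=> Qs; pose e := undup s.
have eQ q : q \in e by rewrite mem_undup.
pose unp i := nth None [seq Some q | q <- e] i.
have pK : pcancel (index^~ e) unp.
  by move=> q; rewrite /unp (nth_map q) ?nth_index ?index_mem.
have fax : Finite.axiom e by move=> q; rewrite count_uniq_mem ?undup_uniq ?eQ.
pose P : finGroupType :=
  HB.pack (Group.sort Q) (isCountable.Build _ pK) (isFinite.Build _ fax).
have [phi phiE] := @hom_of Q P id (fun x y => erefl).
exists P, phi; split.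
- by move=> y; exists y; rewrite phiE.
- by move=> q; rewrite phiE.
- rewrite cardE; apply: (@uniq_leq_size Q); first exact: (@enum_uniq P).
  by move=> q _; apply: Qs.
Qed.

Lemma expp_pgroup (P : finGroupType) p : prime p ->
  (forall x : P, x ^+ p = 1) -> p.-group [set: P]%SET.
Proof.
move=> pp Pp; apply/pgroupP => q qq /(Cauchy qq) [x _ xq].
by rewrite inE /= -(dvdn_prime2 qq pp) -xq order_dvdn Pp.
Qed.

(** The quotient by all [p]-th powers is a finite [p]-group because it has a
    series with factors of order at most [p], one for each infinite factor of
    the given series; it detects [z] because the value at [z] modulo [p] of a
    polynomial function of degree less than [p] is defined on this quotient. *)
Lemma p_quotient (G : groupType) (z : G) n :
  nilpotent_group G -> torsion_free G -> cyclic_series [set: G] n -> z <> 1 ->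
  exists B, forall p, prime p -> (B < p)%N ->
    exists (P : finGroupType) (phi : hom G P) m,
      [/\ p_detects z p phi, #|P| = (p ^ m)%N & (m <= n)%N].
Proof.
move=> nilG tf csn z1.
have sep := torsion_free_separated nilG tf (cyclic_series_max csn).
have [d [f [pf fz]]] := sep z I z1.
have [E E0 cov] := cyclic_series_cover csn.
exists (d + E + `|(f z - f 1%g)%R|)%N => p pp Bp.
have pE : ~~ (p %| E) by apply/negP => /(dvdn_leq E0); lia.
have dlep : (d <= p)%N by lia.
have [pi [spi kpi]] := quotient_hom [set g | exists h : G, g = h ^+ p].
have Qp y : y ^+ p = 1 :> Defs.quotient_group [set g | exists h : G, g = h ^+ p].
  have [x <-] := spi y; rewrite -gmulfXn; apply/kpi => H [_]; apply.
  by exists x.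
have [s sz sP] := cov p pp pE _ pi Qp.
have Qs q : q \in s by have [x <-] := spi q; apply: sP.
have [P [phi [sphi kphi cP]]] := finite_group_of Qs.
have pgP : p.-group [set: P]%SET.
  apply: expp_pgroup => // y; have [q <-] := sphi y.
  by rewrite -gmulfXn Qp gmulf1.
have [m mE] := p_natP pgP.
rewrite cardsT in mE.
exists P, (phi \o pi : hom G P), m; split=> //.
- split=> //.
    by move=> y; have [q <-] := sphi y; have [x <-] := spi q; exists x.
  move=> /= /kphi /kpi /(poly_expp_subgroup pp pf) => /(_ dlep).
  rewrite dvdzE /= => /dvdn_leq; rewrite absz_gt0 subr_eq0.
  by move/(_ (introN eqP fz)); lia.
- by move: (leq_trans cP sz); rewrite mE leq_exp2l // prime_gt1.
Qed.

(** * Finite nilpotent quotients *)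

Lemma lcn_gamma (P : finGroupType) i x :
  (x \in 'L_i.+1([set: P]%SET)) <-> gamma P i.+1 x.
Proof.
elim: i x => [|i IH] x; first by rewrite lcn1 inE.
split=> [|gx].
  pose Y := finset (fun y : P => `[< gamma P i.+2 y >]).
  have gY : group_set Y.
    apply/group_setP; split=> [|u v]; rewrite !inE.
      by apply: (subgroup1 (gamma_subgroup P _)).
    by move=> gu gv; apply: (subgroupM (gamma_subgroup P _)).
  suff /fintype.subsetP sY : 'L_i.+2([set: P]%SET) \subset Group gY.
    by move=> /sY; rewrite inE => /asboolP.
  rewrite lcnSn gen_subG; apply/fintype.subsetP => _ /imset2P [u v /IH gu _ ->].
  by rewrite inE; apply: asboolT; apply: gamma_comm.
have : [set y | y \in 'L_i.+2([set: P]%SET)] x.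
  apply: (generated_min _ _ gx).
    split=> [|u v /= Lu Lv]; first exact: group1.
    by rewrite /= groupM ?groupV.
  by move=> _ [u [v [/IH Lu ->]]] /=; rewrite lcnSn mem_commg ?inE.
by [].
Qed.

Lemma gamma_nilpotent (P : finGroupType) c :
  gamma P c.+1 = [set 1] -> nilpotent [set: P]%SET.
Proof.
move=> gc; apply/lcnP; exists c; apply/eqP; rewrite finset.eqEsubset sub1G andbT.
by apply/fintype.subsetP => x /lcn_gamma; rewrite gc => ->; apply: finset.set11.
Qed.

(** The reason is that, for [t] at least 2, a group of order p ^ t has class
    less than [t]. *)
Lemma small_pgroup_gamma (P : finGroupType) p t c : prime p ->
  #|P| = (p ^ t)%N -> (t <= c)%N -> (1 < c)%N -> forall x, gamma P c x -> x = 1.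
Proof.
move=> pp cP tc c1 x gx.
have pP : p.-group [set: P]%SET by rewrite /pgroup cardsT cP pnatX pnat_id.
move: gx; case: c c1 tc => [//|[//|c]] _ tc /lcn_gamma.
have /(lcn_nil_classP _ (pgroup_nil pP)) -> : (nil_class [set: P]%SET <= c.+1)%N.
  apply: leq_trans (nil_class_pgroup pP) _.
  by rewrite cardsT cP pfactorK // geq_max /=; lia.
by move/finset.set1P.
Qed.

Lemma image_group (N : groupType) (Q : finGroupType) (phi : hom N Q) :
  exists (P : finGroupType) (psi : hom N P),
    [/\ surjective psi, (forall g, psi g = 1 -> phi g = 1) & (#|P| <= #|Q|)%N].
Proof.
have nK : normal_subgroup [set g | phi g = 1].
  split; first split=> [|x y /= x1 y1]; first exact: gmulf1.
    by rewrite /= gmulfF x1 y1 mulgV.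
  by move=> x y /= x1; rewrite /= gmulfJ x1 conj1g.
have [R [pi [spi kpi]]] := normal_quotient_hom nK.
pose pre (y : Q) : R := xget 1 [set r | exists2 g, phi g = y & pi g = r].
have Rs r : r \in [seq pre y | y <- enum Q].
  have [g <-] := spi r; apply/mapP; exists (phi g); first by rewrite mem_enum.
  rewrite /pre; case: xgetP => [_ _ [h hg <-]|/(_ (pi g))]; last by case; exists g.
  by apply/divg1_eq; rewrite -gmulfF; apply/kpi; rewrite /= gmulfF hg mulgV.
have [P [chi [schi kchi cP]]] := finite_group_of Rs.
exists P, (chi \o pi : hom N P); split.
- by move=> y; have [r <-] := schi y; have [g <-] := spi r; exists g.
- by move=> g /kchi /kpi.
- by apply: leq_trans cP _; rewrite size_map -cardE.
Qed.

(** A finite nilpotent group is the product of its Sylow subgroups, so an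
    element with trivial image in all its [p]-quotients is trivial. *)
Lemma p_component (N : groupType) (Q : finGroupType) (phi : hom N Q) g :
  nilpotent_group N -> phi g <> 1 ->
  exists p (P : finGroupType) (psi : hom N P),
    [/\ prime p, p_detects g p psi & (#|P| <= #|Q|)%N].
Proof.
move=> [c gc] phig; have [P0 [psi0 [spsi kpsi cP0]]] := image_group phi.
have nilP0 := gamma_nilpotent (surj_nilpotent spsi gc).
set a := psi0 g; have a1 : a != 1 by apply/eqP => /kpsi.
have oa : (1 < #[a])%N by rewrite order_gt1.
pose p := pdiv #[a]; have pp : prime p by apply: pdiv_prime.
pose K := 'O_p^'([set: P0]%SET)%G.
have nK x : x \in 'N(K).
  have /fintype.subsetP := normal_norm (pcore_normal p^' [set: P0]%SET).
  by apply; rewrite inE.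
have [pi piE] := @hom_of P0 (coset_of K) (coset K)
  (fun x y => morphM (coset_morphism K) (nK x) (nK y)).
exists p, (coset_of K), (pi \o psi0 : hom N (coset_of K)).
have cT : [set: coset_of K]%SET = ([set: P0]%SET / K)%g.
  apply/finset.setP => y; rewrite inE; apply/esym; have [x _ ->] := cosetP y.
  by apply: mem_quotient; rewrite inE.
have cc : #|[set: coset_of K]%SET| = #|[set: P0]%SET : K|.
  by rewrite cT card_quotient // normal_norm // pcore_normal.
split=> //; first split.
- move=> y; have [x _ ->] := cosetP y; have [h <-] := spsi x.
  by exists h; rewrite /= piE.
- rewrite /pgroup cc.
  have /and3P [_ _] := nilpotent_pcore_Hall p^' nilP0.
  by rewrite (eq_pnat _ (negnK _)).
- rewrite /= piE => aK; have {aK} : a \in K by apply: coset_idr.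
  have pK : p^'.-group K by apply: pcore_pgroup.
  move=> /(mem_p_elt pK); rewrite /p_elt p'natE // pdiv_dvd.
  by [].
- apply: leq_trans cP0; rewrite -cardsT cc -[X in (_ <= X)%N]cardsT.
  by apply: dvdn_leq (dvdn_indexg _ _); rewrite cardG_gt0.
Qed.

(** * A small multiple of all prime powers up to a bound *)

(** A substitute for the least common multiple of the integers up to 2 ^ k that
    is easy to bound: by Legendre's formula the prime powers between 2 ^ k and
    2 ^ k.+1 add only primes dividing the central binomial coefficient. *)
Fixpoint binom_prod k : nat :=
  if k is k'.+1 then binom_prod k' * 'C(2 ^ k'.+1, 2 ^ k') else 1.

Lemma bin_leq_exp n m : ('C(n, m) <= 2 ^ n)%N.
Proof.
elim: n m => [|n IH] [|m] //; first by rewrite bin0 expn_gt0.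
by rewrite binS expnS mul2n -addnn leq_add.
Qed.

Lemma binom_prod_le k : (binom_prod k <= 4 ^ (2 ^ k))%N.
Proof.
elim: k => [//|k IH]; rewrite /= [X in (_ <= 4 ^ X)%N]expnS mul2n -addnn expnD.
apply: leq_mul => //; apply: leq_trans (bin_leq_exp _ _) _.
by rewrite -[4%N]/(2 ^ 2)%N -expnM -expnS.
Qed.

Lemma binom_prod_gt0 k : (0 < binom_prod k)%N.
Proof.
by elim: k => //= k IH; rewrite muln_gt0 IH bin_gt0 leq_pexp2l.
Qed.

(** In Legendre's formula for the exponent of [p] in the central binomial
    coefficient, every term is nonnegative, and the term of [p ^ e] is 1. *)
Lemma prime_dvd_central_bin p e m : prime p ->
  (m < p ^ e)%N -> (p ^ e <= 2 * m)%N -> p %| 'C(2 * m, m).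
Proof.
move=> pp me em.
have m2 : (2 * m - m = m)%N by rewrite mul2n -addnn addnK.
have mm : (m <= 2 * m)%N by rewrite leq_pmull.
have C0 : (0 < 'C(2 * m, m))%N by rewrite bin_gt0.
have := bin_fact mm; rewrite m2 => /(congr1 (logn p)).
rewrite !lognM ?muln_gt0 ?fact_gt0 // addnn !logn_fact // => E.
have p1 := prime_gt1 pp.
rewrite -[p]expn1 pfactor_dvdn // lt0n; apply/eqP => L0; move: E; rewrite L0 add0n.
have -> : (\sum_(1 <= k < m.+1) m %/ p ^ k =
           \sum_(1 <= k < (2 * m).+1) m %/ p ^ k)%N.
  rewrite [RHS](big_cat_nat _ (n := m.+1)) //= [X in (_ + X)%N]big_nat_cond.
  rewrite [X in (_ + X)%N]big1 ?addn0 //.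
  move=> i /andP [/andP [mi _] _]; apply: divn_small.
  by apply: leq_trans mi _; apply/ltnW/ltn_expl.
rewrite -mul2n big_distrr /=; apply/eqP; rewrite neq_ltn; apply/orP; left.
have e0 : (0 < e)%N by case: (e) me em => // me em; rewrite expn0 in me em; lia.
have e2 : (e <= 2 * m)%N by apply: leq_trans (ltnW (ltn_expl e p1)) em.
have ein : e \in index_iota 1 (2 * m).+1 by rewrite mem_index_iota e0 ltnS.
rewrite !(bigD1_seq e) ?iota_uniq //= -addSn.
apply: leq_add.
  by rewrite divn_small // muln0 divn_gt0 // expn_gt0 prime_gt0.
apply: leq_sum => i _; rewrite leq_divRL ?expn_gt0 ?prime_gt0 //.
by rewrite -mulnA leq_mul2l leq_divM.
Qed.

(** Between 2 ^ k and 2 ^ k.+1 the exponent of [p] grows by at most one, and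
    the central binomial coefficient supplies that factor. *)
Lemma dvdn_binom_prod k p e : prime p -> (p ^ e <= 2 ^ k)%N -> p ^ e %| binom_prod k.
Proof.
move=> pp; elim: k e => [|k IH] e.
  case: e => [//|e]; rewrite leqNgt expn0 -(expn0 p) ltn_exp2l ?prime_gt1 //.
move=> pe; have [pek|kpe] := leqP (p ^ e)%N (2 ^ k).
  by apply: dvdn_mulr; apply: IH.
case: e pe kpe => [|e] pe kpe; first by rewrite expn0 dvd1n.
rewrite expnSr; apply: dvdn_mul.
  apply: IH; rewrite -(leq_pmul2l (isT : 0 < 2)%N) -expnS.
  by apply: leq_trans pe; rewrite expnS leq_mul2r prime_gt1 // orbT.
by rewrite expnS; apply: prime_dvd_central_bin kpe _; rewrite // -expnS.
Qed.

(** * The residual dimension *)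

Lemma finite_nat_bounded (A : set nat) :
  finite_set A -> exists B, forall a, A a -> (a <= B)%N.
Proof.
move/finite_seqP => [s ->]; exists (sumn s) => a /=.
elim: s => //= b s IH; rewrite inE => /orP [/eqP ->|/IH]; first exact: leq_addr.
by move=> as_; apply: leq_trans as_ (leq_addl _ _).
Qed.

Lemma bounded_below (A : nat -> set nat) d :
  (forall k, (k < d)%N -> finite_set (A k)) ->
  exists B, forall k a, (k < d)%N -> A k a -> (a <= B)%N.
Proof.
elim: d => [|d IH] fA; first by exists 0%N.
have [|B HB] := IH; first by move=> k kd; apply: fA; apply: ltnW.
have [B' HB'] := finite_nat_bounded (fA d (ltnSn d)).
exists (maxn B B') => k a; rewrite ltnS leq_eqVlt => /orP [/eqP ->|kd] Aa.
  by rewrite leq_max HB' ?orbT.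
by rewrite leq_max (HB k).
Qed.

Lemma pgroup_expg_eq1 (P : finGroupType) p (x : P) j : prime p ->
  p.-group [set: P]%SET -> (0 < j < p)%N -> x ^+ j = 1 -> x = 1.
Proof.
move=> pp pP /andP [j0 jp] xj; apply/eqP; rewrite -order_eq1 -dvdn1.
have co : coprime #[x] j.
  apply: (pnat_coprime (pi := p)); first by apply: (mem_p_elt pP); rewrite inE.
  by rewrite p'natE //; apply/negP => /(dvdn_leq j0); rewrite leqNgt jp.
by rewrite -(eqP co) dvdn_gcd dvdnn order_dvdn xj eqxx.
Qed.

Section TorsionFreeNilpotent.
Variable G : groupType.
Hypothesis nilG : nilpotent_group G.
Hypothesis fgG : finitely_generated G.
Hypothesis tfG : torsion_free G.
Implicit Types (x y z : G).
Local Notation h := (hirsch_length G).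

Lemma hirsch_series : cyclic_series [set: G] h.
Proof.
have [n csn] := nilpotent_cyclic_series fgG nilG.
by rewrite /hirsch_length; case: xgetP => [m _ //|no]; case: (no n csn).
Qed.

Lemma zexpg_eq1 z a : z <> 1 -> zexpg z a = 1 -> a = 0%R.
Proof.
move=> z1; case: a => [[//|n]|n] /= zn; case: z1; apply: tfG; exists n.+1 => //.
by apply: invg_inj; rewrite invg1.
Qed.

(** Maximal cyclic subgroups exist by the maximal condition, and are generated
    by primitive elements. *)
Lemma primitive_root y : y <> 1 ->
  exists2 z, primitive z & exists2 m, m != 0%R & y = zexpg z m.
Proof.
move=> y1; pose cyc z := [set g | exists m, g = zexpg z m].
have cycS z : subgroup (cyc z).
  split; first by exists 0%R.
  by move=> _ _ [a ->] [b ->]; exists (a - b)%R; rewrite zexpgB.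
have cycM g z : cyc z g -> cyc g `<=` cyc z.
  by move=> [m ->] _ [n ->]; exists (m * n)%R; rewrite zexpgM.
have cyc_id z : cyc z z by exists 1%R.
pose F := [set A | exists2 z, A = cyc z & cyc z y].
have [||_ [z -> [m ym]] maxz] := cyclic_series_max hirsch_series (F := F).
- by exists (cyc y), y.
- by move=> _ [z -> _]; split.
have z1 : z <> 1.
  move=> z1; apply: y1; rewrite ym z1.
  by case: (m) => n /=; rewrite expg1n ?invg1.
exists z; last first.
  by exists m => //; apply/eqP => m0; apply: y1; rewrite ym m0.
split=> [/tfG //|g n n0 gn].
have [|||k gk] := maxz (cyc g) _ _ g.
- by exists g => //; exists (n * m)%R; rewrite zexpgM gn.
- by apply: cycM; exists n.
- exact: cyc_id.
have kn : (k * n = 1)%R.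
  apply/eqP; rewrite -subr_eq0; apply/eqP; apply: (zexpg_eq1 z1).
  by rewrite zexpgB zexpgM -gk gn mulgV.
have [k1|k1] : k = 1%R \/ k = (-1)%R.
  move/(congr1 absz): kn => /eqP; rewrite abszM muln_eq1 => /andP [/eqP k1 _].
  by case: (k) k1 => [k'|[|k']] //= => [->|_]; [left|right].
- by left; rewrite gk k1.
- by right; rewrite gk k1 /= invgK.
Qed.

(** For all large [p], the quotients of exponent [p] show that witnesses exist;
    quotients of order above [p ^ h] are compared with [h] itself. *)
Lemma witness_spec z : z <> 1 -> exists B, forall p, prime p -> (B < p)%N ->
  [/\ RP z (witness_exponent z p) p,
      (1 <= witness_exponent z p <= h)%N &
      forall (P : finGroupType) (phi : hom G P) m, p_detects z p phi ->
        #|P| = (p ^ m)%N -> (witness_exponent z p <= m)%N].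
Proof.
move=> z1; have [B det] := p_quotient nilG tfG hirsch_series z1.
exists B => p pp Bp; have [P [phi [m [dphi cP mh]]]] := det p pp Bp.
have p1 := prime_gt1 pp.
pose W k := exists (Q : finGroupType) (psi : hom G Q),
    [/\ p_detects z p psi, #|Q| = (p ^ k)%N & (p ^ k <= p ^ h)%N].
have [[Q [psi [dpsi cQ wh]]] wmin] : W (witness_exponent z p) /\
    forall k, W k -> (witness_exponent z p <= k)%N.
  by apply: nat_minP; exists m, P, phi; rewrite leq_exp2l.
rewrite leq_exp2l // in wh; split.
- by split=> //; exists Q, psi; split.
- rewrite wh andbT lt0n; apply/eqP => w0; rewrite w0 expn0 in cQ.
  have /card_le1_eqP Q1 : (#|Q| <= 1)%N by rewrite cQ.
  by case: dpsi => _ _; apply; apply: Q1.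
- move=> P' phi' m' d' c'; have [m'h|hm'] := leqP m' h.
    by apply: wmin; exists P', phi'; rewrite leq_exp2l.
  exact: leq_trans wh (ltnW hm').
Qed.

(** Witness exponents take values in [1, h] for all large [p], so one value is
    taken infinitely often; the smaller ones occur for finitely many [p], hence
    for large [p] the dimension bounds the order of every [p]-quotient that
    detects [z]. *)
Lemma dim_RFL_at_spec z : z <> 1 ->
  [/\ (1 <= dim_RFL_at z <= h)%N, infinite_set (RP z (dim_RFL_at z)) &
      exists B, forall p, prime p -> (B < p)%N ->
        forall (P : finGroupType) (phi : hom G P) m, p_detects z p phi ->
        #|P| = (p ^ m)%N -> (dim_RFL_at z <= m)%N].
Proof.
move=> z1; have [B spec] := witness_spec z1.
pose D t := (1 <= t <= h)%N /\ infinite_set (RP z t).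
have [[dh inf] dmin] : D (dim_RFL_at z) /\ forall k, D k -> (dim_RFL_at z <= k)%N.
  apply: nat_minP; apply: contrapT => /forallNP noD.
  have [C HC] : exists C, forall k a, (k < h)%N -> RP z k.+1 a -> (a <= C)%N.
    apply: bounded_below => k kh; apply: contrapT => inf.
    by apply: (noD k.+1); split.
  have [p Mp pp] := prime_above (maxn B C).
  have [|Rp /andP [w1 wh] _] := spec p pp.
    by apply: leq_ltn_trans Mp; apply: leq_maxl.
  have := HC (witness_exponent z p).-1 p; rewrite prednK // => /(_ wh Rp).
  by rewrite leqNgt (leq_ltn_trans _ Mp) // leq_maxr.
split=> //.
have [C HC] : exists C, forall k a, (k < dim_RFL_at z)%N ->
    (RP z k `&` [set _ | (0 < k)%N]) a -> (a <= C)%N.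
  apply: bounded_below => k kd; apply: contrapT => infk.
  have k0 : (0 < k)%N.
    rewrite lt0n; apply/eqP => k0; apply: infk; rewrite k0.
    by apply: sub_finite_set (finite_set0 nat) => a [].
  have := dmin k; rewrite leqNgt kd => /(_ _) /negP; apply=> //; split.
    by rewrite k0 /= (leq_trans (ltnW kd)) //; case/andP: dh.
  by move=> fk; apply: infk; apply: sub_finite_set fk => a [].
exists (maxn B C) => p pp Mp P phi m dphi cP.
have [|Rp /andP [w1 wh] wle] := spec p pp.
  by apply: leq_ltn_trans Mp; apply: leq_maxl.
rewrite leqNgt; apply/negP => md.
have wd := leq_ltn_trans (wle P phi m dphi cP) md.
have := HC _ p wd (conj Rp w1).
by rewrite leqNgt (leq_ltn_trans _ Mp) // leq_maxr.
Qed.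

(** A [p]-group of order at most [p ^ c] has class less than [c], so it kills
    [gamma_c], and also, when [p] is large, the element [z] of the isolator. *)
Lemma dim_RFL_at_gt_step c z : (1 < c)%N -> isolator (gamma G c) z -> z <> 1 ->
  (c < dim_RFL_at z)%N.
Proof.
move=> c1 [j j0 gzj] z1; have [/andP [d1 dh] inf _] := dim_RFL_at_spec z1.
rewrite ltnNge; apply/negP => dc; apply: inf.
apply: sub_finite_set (finite_II j.+1) => p [pp [P [phi [[[_ pP phiz] _] cP]]]].
rewrite /= ltnS leqNgt; apply/negP => jp; apply: phiz.
have phij : phi z ^+ j = 1.
  rewrite -gmulfXn; apply: (small_pgroup_gamma pp cP dc c1); exact: hom_gamma.
by apply: (pgroup_expg_eq1 pp pP _ phij); rewrite j0.
Qed.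
Lemma dim_RFL_torsion_free_spec :
  (1 < step_length G)%N ->
  (step_length G < dim_RFL_torsion_free G)%N /\
  exists z, z <> 1 /\ dim_RFL_at z = dim_RFL_torsion_free G.
Proof.
set c := step_length G => c1.
have [c0 gc] : (0 < c)%N /\ gamma G c.+1 = [set 1].
  by move: c1; rewrite /c /step_length /nat_min; case: xgetP => // m _ [].
have gc' : gamma G c <> [set 1].
  move=> g1; suff : (c <= c.-1)%N by lia.
  pose A a := (0 < a)%N /\ gamma G a.+1 = [set 1].
  have [_] : A c /\ forall k, A k -> (c <= k)%N by apply: nat_minP; exists c.
  by apply; split; [lia | rewrite prednK].
have [y gy y1] : exists2 y, gamma G c y & y <> 1.
  apply: contrapT => no; apply: gc'; apply/seteqP; split=> [y gy|_ ->].
    by apply: contrapT => y1; apply: no; exists y.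
  exact: (subgroup1 (gamma_subgroup G c)).
have prim1 z : primitive z -> z <> 1.
  by move=> [tz _] z1; apply: tz; rewrite z1; exists 1%N.
have [z pz [m m0 ym]] := primitive_root y1.
have iz : isolator (gamma G c) z.
  exists `|m|%N; first by rewrite absz_gt0.
  case: (m) ym => n /= yn; first by rewrite -yn.
  by rewrite -[_ ^+ _]invgK -yn; apply: subgroupV => //; apply: gamma_subgroup.
pose D d := exists z,
  [/\ isolator (gamma G c) z, primitive z & dim_RFL_at z = d].
have [[z' [iz' pz' dz']] _] : D (dim_RFL_torsion_free G) /\
    forall k, D k -> (k <= dim_RFL_torsion_free G)%N.
  apply: (@nat_maxP _ h); first by exists (dim_RFL_at z), z.
  by move=> _ [u [_ pu <-]]; case: (dim_RFL_at_spec (prim1 u pu)) => /andP [].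
rewrite -dz'; split; last by exists z'; split=> //; apply: prim1.
by apply: dim_RFL_at_gt_step => //; apply: prim1.
Qed.

End TorsionFreeNilpotent.

(** * Growth *)

Section WordLength.
Variables (N : groupType) (S : seq N).
Hypothesis gS : generates S.
Implicit Types (g : N) (w : seq N).

Let lengths g := [set l | exists2 w, words S w & \prod_(x <- w) x = g /\ size w = l].

Lemma word_length_spec g : lengths g (word_length S g) /\
  forall l, lengths g l -> (word_length S g <= l)%N.
Proof. by apply: nat_minP; have [w ww wg] := gS g; exists (size w), w. Qed.

Lemma word_lengthX g k : (word_length S (g ^+ k) <= k * word_length S g)%N.
Proof.
have [[w ww [wg wl]] _] := word_length_spec g.
apply: (word_length_spec _).2; rewrite -wl.
elim: k => [|k [v vw [vg vl]]]; first by exists [::]; rewrite ?big_nil.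
exists (w ++ v); first by move=> x; rewrite mem_cat => /orP [/ww|/vw].
by rewrite big_cat /= wg vg -expgS size_cat vl mulSn.
Qed.

Lemma words_bounded (f : seq N -> nat) n :
  exists B, forall w, words S w -> (size w <= n)%N -> (f w <= B)%N.
Proof.
elim: n f => [|n IH] f; first by exists (f [::]) => -[].
pose A := S ++ [seq x^-1 | x <- S].
suff [B HB] : exists B, forall x w, x \in A -> words S w ->
    (size w <= n)%N -> (f (x :: w) <= B)%N.
  exists (maxn (f [::]) B) => -[|x w] ww wn; first exact: leq_maxl.
  rewrite leq_max HB ?orbT //; last first.
    by move=> y yw; apply: ww; rewrite inE yw orbT.
  rewrite mem_cat; case: (ww x); rewrite ?inE ?eqxx // => xS; apply/orP.
    by left.
  right.
  by apply/mapP; exists x^-1; rewrite ?invgK.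
elim: A => [|a A [B HB]]; first by exists 0%N.
have [B' HB'] := IH (fun w => f (a :: w)).
exists (maxn B B') => x w; rewrite inE => /orP [/eqP ->|xA] ww wn.
  by rewrite leq_max HB' ?orbT.
by rewrite leq_max HB.
Qed.

Lemma rf_growth_ge g n : g <> 1 -> (word_length S g <= n)%N ->
  (rf_depth g <= rf_growth S n)%N.
Proof.
move=> g1 gn; have [B HB] := words_bounded (fun w => rf_depth (\prod_(x <- w) x)) n.
pose D d := exists g, [/\ g <> 1, (word_length S g <= n)%N & rf_depth g = d].
have [_] : D (rf_growth S n) /\ forall k, D k -> (k <= rf_growth S n)%N.
  apply: (@nat_maxP _ B); first by exists (rf_depth g), g.
  move=> _ [u [_ un <-]]; have [[w ww [wu wl]] _] := word_length_spec u.
  by rewrite -wu; apply: (HB w ww); rewrite wl.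
by apply; exists g.
Qed.

End WordLength.

Lemma surj_finitely_generated (G Q : groupType) (pi : hom G Q) :
  surjective pi -> finitely_generated G -> finitely_generated Q.
Proof.
move=> spi [S gS]; exists [seq pi s | s <- S] => q.
have [g <-] := spi q; have [w ww <-] := gS g.
exists [seq pi x | x <- w]; last by rewrite big_map gmulf_prod.
move=> _ /mapP [x /ww xS ->]; rewrite -gmulfV.
by case: xS => xS; [left|right]; apply: map_f.
Qed.

(** A finite quotient detecting a high power of a preimage of [z] may be
    replaced by a [p]-group. For [p <= 2 ^ k] this power kills every [p]-group
    of order at most [2 ^ (k * d)]. For larger [p], torsion is killed and the
    quotient factors through [M], so that the definition of the dimension [d]
    bounds its order by [p ^ d] from below. *)
Lemma depth_lower_bound (N M : groupType) (pi : hom N M) (zN : N) :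
  nilpotent_group N -> finitely_generated N -> torsion_free M ->
  surjective pi -> (forall x, pi x = 1 <-> torsion N x) -> pi zN <> 1 ->
  let d := dim_RFL_at (pi zN) in
  exists k0, forall k, (k0 <= k)%N ->
    let g := zN ^+ (binom_prod k ^ (2 * d)) in
    g <> 1 /\ ((2 ^ k) ^ d <= rf_depth g)%N.
Proof.
move=> nilN fgN tfM spi kpi z1 d.
have nilM : nilpotent_group M.
  by case: nilN => c gc; exists c; apply: surj_nilpotent spi gc.
have fgM := surj_finitely_generated spi fgN.
have [/andP [d0 _] _ [B HB]] := dim_RFL_at_spec nilM fgM tfM z1.
have [nN csN] := nilpotent_cyclic_series fgN nilN.
have [E E0 EP] := cyclic_series_torsion csN.
exists (B + E)%N => k k0 g; set n := (2 ^ k)%N.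
have kn : (k < n)%N by apply: ltn_expl.
have L0 : (0 < binom_prod k ^ (2 * d))%N by rewrite expn_gt0 binom_prod_gt0.
have pig : pi g <> 1.
  move=> pig1; apply: z1; apply: tfM; exists (binom_prod k ^ (2 * d))%N => //.
  by rewrite -gmulfXn.
split; first by move=> g1; apply: pig; rewrite g1 gmulf1.
pose D q := exists (Q : finGroupType) (phi : hom N Q), phi g <> 1 /\ #|Q| = q.
have [[Q [phi [phig <-]]] _] : D (rf_depth g) /\
    forall q, D q -> (rf_depth g <= q)%N.
  have [B' det] := p_quotient nilM tfM (hirsch_series nilM fgM) pig.
  apply: nat_minP; have [p Bp pp] := prime_above B'.
  have [P [phi [m [[_ _ phig] _ _]]]] := det p pp Bp.
  by exists #|P|, P, (phi \o pi : hom N P).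
have [p [P [psi [pp [spsi pP psig] cPQ]]]] := p_component nilN phig.
apply: leq_trans cPQ; have [m mE] := p_natP pP; rewrite cardsT in mE; rewrite mE.
have p1 := prime_gt1 pp; have n0 : (0 < n)%N by rewrite expn_gt0.
have psigE : psi g = psi zN ^+ (binom_prod k ^ (2 * d)) by rewrite gmulfXn.
have [pn|np] := leqP p n.
  (* e < e.+1 <= 2 e, so the factor 2 in the exponent of [g] makes up for the
     difference between n and the largest power of [p] below it *)
  set e := trunc_log p n.
  have pe : (p ^ e <= n)%N by apply: trunc_logP.
  have npe : (n < p ^ e.+1)%N by apply: trunc_log_ltn.
  have e0 : (0 < e)%N by rewrite trunc_log_gt0 p1 /=; lia.
  have pL : p ^ (e * (2 * d)) %| binom_prod k ^ (2 * d).
    by rewrite expnM dvdn_exp2r // dvdn_binom_prod.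
  have em : (e * (2 * d) < m)%N.
    rewrite ltnNge; apply/negP => me; apply: psig; rewrite psigE.
    apply/eqP; rewrite -order_dvdn; apply: dvdn_trans pL.
    have : #[psi zN] %| #|[set: P]%SET| by apply: order_dvdG; rewrite inE.
    rewrite cardsT mE => /dvdn_trans; apply; exact: dvdn_exp2l.
  apply: (@leq_trans ((p ^ e.+1) ^ d)); first by rewrite leq_exp2r // ltnW.
  by rewrite -expnM leq_exp2l //; nia.
have ker x : pi x = 1 -> psi x = 1.
  move=> /kpi tx; apply: (pgroup_expg_eq1 (j := E) pp pP).
    by rewrite E0 /=; lia.
  by rewrite -gmulfXn EP // gmulf1.
have [chi chiE] := factor_hom spi ker.
have dchi : p_detects (pi zN) p chi.
  split=> //; first by move=> y; have [x <-] := spsi y; exists (pi x).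
  by rewrite chiE => psiz; apply: psig; rewrite psigE psiz expg1n.
have dm : (d <= m)%N by apply: (HB p pp _ P chi) => //; lia.
apply: (@leq_trans (p ^ d)); last by rewrite leq_exp2l.
by rewrite leq_exp2r // ltnW.
Qed.

(** The arguments at which [F] is controlled are singly exponential in 2 ^ k, so
    2 ^ k can be taken proportional to the logarithm of the argument; rounding
    it to a power of two costs a constant factor. *)
Lemma log_power_growth (F : nat -> nat) d l k0 : (0 < d)%N ->
  (forall n k, (k0 <= k)%N -> ((4 ^ (2 ^ k)) ^ (2 * d) * l <= n)%N ->
     ((2 ^ k) ^ d <= F n)%N) ->
  exists2 C, (0 < C)%N & forall n, (0 < n)%N ->
    ((trunc_log 2 n).+1 ^ d <= C * F (C * n))%N.
Proof.
move=> d0 HF.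
have e4 k : ((4 ^ (2 ^ k)) ^ (2 * d) = 2 ^ (4 * d * 2 ^ k))%N.
  by rewrite -[4%N in LHS]/(2 ^ 2)%N -!expnM; congr (2 ^ _)%N; lia.
(* the first factor accounts for [l], the second one for the arguments whose
   logarithm is too small to allow [k0 <= k], and the last one for the constant
   of proportionality between 2 ^ k and the logarithm *)
pose C := (l.+1 * 2 ^ (4 * d * 2 ^ k0) * (8 * d) ^ d)%N.
have C8 : (0 < (8 * d) ^ d)%N by rewrite expn_gt0 muln_gt0 d0.
have Cl : (l * 2 ^ (4 * d * 2 ^ k0) <= C)%N.
  by rewrite /C -[X in (X <= _)%N]muln1; do 2?apply: leq_mul.
have C0 : (0 < C)%N by rewrite !muln_gt0 expn_gt0 C8.
exists C => // n n0; set m := trunc_log 2 n.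
have mn : (2 ^ m <= n)%N by apply: trunc_logP.
set q := (m %/ (4 * d))%N; set k1 := trunc_log 2 q.
pose k := maxn k1 k0.
have qk : (q < 2 ^ k1.+1)%N by apply: trunc_log_ltn.
have mq : (m < q.+1 * (4 * d))%N by rewrite ltn_ceil // muln_gt0.
have mk : (m.+1 <= 8 * d * 2 ^ k)%N.
  apply: leq_trans mq _.
  apply: (@leq_trans (2 ^ k1.+1 * (4 * d))); first by rewrite leq_mul2r qk orbT.
  have : (2 ^ k1 <= 2 ^ k)%N by rewrite leq_exp2l // leq_maxl.
  by rewrite expnS; nia.
have Fk : ((2 ^ k) ^ d <= F (C * n))%N.
  apply: HF; first exact: leq_maxr.
  rewrite e4 /k; have [k10|k01] := leqP k1 k0.
    rewrite mulnC; apply: leq_trans Cl _; exact: leq_pmulr.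
  have q0 : (0 < q)%N.
    by rewrite lt0n; apply/eqP => q0; move: k01; rewrite /k1 q0 trunc_log0.
  have k1q : (2 ^ k1 <= q)%N by apply: trunc_logP.
  have : (4 * d * 2 ^ k1 <= m)%N.
    apply: (@leq_trans (4 * d * q)); first by rewrite leq_mul2l k1q orbT.
    by rewrite mulnC leq_divM.
  rewrite -(leq_exp2l _ _ (isT : 1 < 2)%N) => /leq_trans /(_ mn) kn.
  rewrite mulnC; apply: leq_mul kn; apply: leq_trans Cl; rewrite -[X in (X <= _)%N]muln1.
  by apply: leq_mul => //; rewrite expn_gt0.
apply: (@leq_trans ((8 * d * 2 ^ k) ^ d)); first by rewrite leq_exp2r.
rewrite expnMn; apply: leq_mul => //.
by rewrite /C leq_pmull // muln_gt0 expn_gt0.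
Qed.

Lemma ln_le_trunc_log (R : realType) n : (0 < n)%N ->
  (0 <= ln (n%:R : R) <= (trunc_log 2 n).+1%:R)%R.
Proof.
move=> n0; have nR : (0 < n%:R :> R)%R by rewrite ltr0n.
rewrite ln_ge0 ?ler1n //=; set m := (trunc_log 2 n).+1.
have : (n%:R <= expR (m%:R : R))%R.
  rewrite -[X in expR X]mulr1 expRM_natl; apply: (@le_trans _ _ (2 ^+ m)%R).
    by rewrite -natrX ler_nat ltnW // trunc_log_ltn.
  rewrite lerXn2r ?nnegrE ?expR_ge0 //.
  by have := expR_ge1Dx (1 : R); rewrite -[(1 + 1)%R]/(2%:R)%R.
move=> nm; rewrite -[leRHS](@expRK R) ler_ln ?posrE ?expR_gt0 //.
Qed.

Theorem theorem1p2 (R : realType) (N : groupType) (c : nat)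
  (N_infinite : infinite_set [set: N])
  (N_fg : finitely_generated N)
  (N_nilpotent : nilpotent_group N)
  (N_step : step_length (mod_torsion N) = c)
  (c_gt1 : (1 < c)%N) :
  (c + 1 <= dim_RFL N)%N /\
  forall S : seq N, generates S ->
    precsim (fun n => (ln (n%:R : R) ^+ dim_RFL N)%R)
            (fun n => (rf_growth S n)%:R%R).
Proof.
have [pi [spi kpi]] := mod_torsion_hom N_nilpotent.
have tfM := mod_torsion_free N_nilpotent.
have nilM : nilpotent_group (mod_torsion N).
  by case: N_nilpotent => c' gc'; exists c'; apply: surj_nilpotent spi gc'.
have fgM := surj_finitely_generated spi N_fg.
have c1 : (1 < step_length (mod_torsion N))%N by rewrite N_step.
have [cd [z [z1 zd]]] := dim_RFL_torsion_free_spec nilM fgM tfM c1.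
rewrite N_step -/(dim_RFL N) in cd; rewrite -/(dim_RFL N) in zd.
split=> [|S gS]; first by rewrite addn1.
have [zN zE] := spi z; subst z.
have [k0] := depth_lower_bound N_nilpotent N_fg tfM spi kpi z1.
rewrite zd; set d := dim_RFL N => Hk.
have d0 : (0 < d)%N by apply: leq_ltn_trans cd.
have growth n k : (k0 <= k)%N ->
    ((4 ^ (2 ^ k)) ^ (2 * d) * word_length S zN <= n)%N ->
    ((2 ^ k) ^ d <= rf_growth S n)%N.
  move=> k0k nk; have [g1 gd] := Hk k k0k.
  apply: leq_trans gd _; apply: rf_growth_ge => //.
  apply: leq_trans (word_lengthX gS _ _) _; apply: leq_trans nk.
  by rewrite leq_mul2r leq_exp2r ?binom_prod_le ?orbT // muln_gt0.
have [C C0 HC] := log_power_growth d0 growth.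
exists C => // n n0; have /andP [ln0 lnm] := ln_le_trunc_log R n0.
apply: (@le_trans _ _ ((trunc_log 2 n).+1%:R ^+ d)%R).
  by rewrite lerXn2r ?nnegrE.
by rewrite -natrX -natrM ler_nat HC.
Qed.
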